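(* Let $\beta\in[0,\infty)$ and let $R\subseteq\Lambda$ be star-connected and plaquette-connected with $|R|\ge2$. Then $$\ker(\mathcal L^{(\beta)}_R)=\big(1_R\otimes\mathcal B(\mathcal H_{\Lambda\setminus R})\big)\cap\{A_s,B_p\;:\;s\in\mathcal S_R,\ p\in\mathcal P_R\}'.$$
   Context: Model: Let $G$ be a finite Abelian group with identity $1$, write $\bar g=g^{-1}$, and let $\hat G$ be its character group (homomorphisms $G\to U(1)$ under pointwise multiplication), with $\bar\chi$ the complex-conjugate character. For $N\ge2$, $\Lambda=\Lambda_N$ is the set of edges of the square lattice on the torus $\mathbb Z_N\times\mathbb Z_N$; horizontal edges are oriented to the left, vertical edges downward. Each edge $e$ carries $\mathcal H_e=\ell^2(G)$ with orthonormal basis $\{|g\rangle\}_{g\in G}$; for $V\subseteq\Lambda$, $\mathcal H_V=\bigotimes_{e\in V}\mathcal H_e$ and $\mathcal B(\mathcal H_V)$ is identified with $\mathcal B(\mathcal H_V)\otimes 1_{\Lambda\setminus V}\subseteq\mathcal B(\mathcal H_\Lambda)$. On $\ell^2(G)$ let $L^g=\sum_{h}|gh\rangle\langle h|$ and $M^\chi=\sum_g\chi(g)|g\rangle\langle g|$; $L^g_e,M^\chi_e$ act on edge $e$. A star $s$ is a vertex; $ds$ is the set of its four incident edges and $d_+s$ (resp. $d_-s$) those oriented away from (resp. towards) the vertex. A plaquette $p$ is a face; $\partial p$ is the set of its four boundary edges and $\partial_+p$ (resp. $\partial_-p$) those oriented counterclockwise (resp. clockwise). Set $A_s(g)=\prod_{e\in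 d_+s}L^g_e\prod_{e\in d_-s}L^{\bar g}_e$, $B_p(\chi)=\prod_{e\in\partial_+p}M^\chi_e\prod_{e\in\partial_-p}M^{\bar\chi}_e$, $A_s=\frac1{|G|}\sum_gA_s(g)$, $B_p=\frac1{|G|}\sum_\chi B_p(\chi)$. For $V\subseteq\Lambda$, $\mathcal S_V$ is the set of stars with $ds\cap V\neq\emptyset$, $\mathcal P_V$ the set of plaquettes with $\partial p\cap V\ne\emptyset$, and $H_V=-\sum_{s\in\mathcal S_V}A_s-\sum_{p\in\mathcal P_V}B_p$. Connectivity: $R\subseteq\Lambda$ is star-connected if for all $e,e'\in R$ there is a sequence $e=e_0,s_1,e_1,\dots,s_n,e_n=e'$ with $e_i\in R$ and $e_{i-1},e_i\in ds_i$; plaquette-connected is defined analogously with plaquettes $p_i$ and $e_{i-1},e_i\in\partial p_i$. Davies dynamics: For each edge $e$ there is a finite set $\mathcal S_e=\{S_{e,i}:i\in I\}\subset\mathcal B(\mathcal H_e)$ of bare jump operators that is closed under adjoints and whose commutant in $\mathcal B(\mathcal H_e)$ is $\mathbb C1$. Let $P_\lambda$ be the spectral projections of $H_\Lambda$, $\Omega$ the set of differences of eigenvalues of $H_\Lambda$, and $Q(\omega)=\sum_{\lambda-\lambda'=\omega}P_\lambda QP_{\lambda'}$ for $Q\in\mathcal B(\mathcal H_\Lambda)$. Rates $h^{(\beta)}_{e,i}(\omega)>0$ satisfy $h^{(\beta)}_{e,i}(-\omega)=h^{(\beta)}_{e,i}(\omega)e^{-\beta\omega}$. For $V\subseteq\Lambda$,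 $\mathcal L^{(\beta)}_V=\sum_{e\in V}\mathcal D_e$ with $\mathcal D_e(O)=\sum_{i,\omega}h^{(\beta)}_{e,i}(\omega)\big(S_{e,i}(\omega)^\dagger OS_{e,i}(\omega)-\tfrac12\{S_{e,i}(\omega)^\dagger S_{e,i}(\omega),O\}\big)$. *)

(* Defs.v *)
From HB Require Import structures.
From mathcomp Require Import all_boot all_order all_algebra all_fingroup.
From mathcomp Require Import all_classical all_reals.
From mathcomp Require Import analysis.sequences analysis.exp.
From mathcomp Require Import complex.

Set Implicit Arguments.
Unset Strict Implicit.
Unset Printing Implicit Defensive.

Import Order.TTheory GRing.Theory Num.Theory.
Local Open Scope ring_scope.

Section QD.
Variable R : realType.
Local Notation C := (R[i]).

(* Vertices of Z_N x Z_N: (x,y); x grows to the right, y grows upwards.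
   Edge (x,y,true)  = horizontal edge between (x,y) and (x+1,y),
                      oriented to the left: from (x+1,y) to (x,y).
   Edge (x,y,false) = vertical edge between (x,y) and (x,y+1),
                      oriented downwards: from (x,y+1) to (x,y).
   Plaquette (x,y) = face with corners (x,y),(x+1,y),(x+1,y+1),(x,y+1). *)
Definition edge (N : nat) := ('I_N * 'I_N * bool)%type.
Definition vertex (N : nat) := ('I_N * 'I_N)%type.
Definition plaq (N : nat) := ('I_N * 'I_N)%type.

Definition hE N (x y : 'I_N) : edge N := (x, y, true).
Definition vE N (x y : 'I_N) : edge N := (x, y, false).

(* edges incident to the star s, oriented away from / towards s *)
Definition dplus N (s : vertex N) : {set edge N} :=
  [set hE (ord_pred s.1) s.2; vE s.1 (ord_pred s.2)].
Definition dminus N (s : vertex N) : {set edge N} :=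
  [set hE s.1 s.2; vE s.1 s.2].
Definition dstar N (s : vertex N) : {set edge N} := dplus s :|: dminus s.

(* boundary edges of the plaquette p oriented counterclockwise / clockwise *)
Definition bplus N (p : plaq N) : {set edge N} :=
  [set hE p.1 (ordS p.2); vE p.1 p.2].
Definition bminus N (p : plaq N) : {set edge N} :=
  [set hE p.1 p.2; vE (ordS p.1) p.2].
Definition bplaq N (p : plaq N) : {set edge N} := bplus p :|: bminus p.

Definition stars_of N (V : {set edge N}) : {set vertex N} :=
  [set s | ~~ [disjoint dstar s & V]].
Definition plaqs_of N (V : {set edge N}) : {set plaq N} :=
  [set p | ~~ [disjoint bplaq p & V]].

Definition star_adj N : rel (edge N) :=
  fun e e' => [exists s, (e \in dstar s) && (e' \in dstar s)].
Definition plaq_adj N : rel (edge N) :=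
  fun e e' => [exists p, (e \in bplaq p) && (e' \in bplaq p)].

Definition connected_by N (adj : rel (edge N)) (V : {set edge N}) : Prop :=
  forall e e', e \in V -> e' \in V ->
    exists q : seq (edge N), [/\ path adj e q, last e q = e' & all (mem V) q].

Definition star_connected N (V : {set edge N}) := connected_by (@star_adj N) V.
Definition plaquette_connected N (V : {set edge N}) := connected_by (@plaq_adj N) V.

Variable gT : finGroupType.

(* single-edge space l^2(G): operators are matrices indexed by enum of gT *)
Definition siteOp := 'M[C]_#|{: gT}|.
Definition site_mx (f : gT -> gT -> C) : siteOp :=
  \matrix_(i, j) f (enum_val i) (enum_val j).

(* basis configurations of H_Lambda *)
Definition cfg N := {ffun edge N -> gT}.
Definition Op N := 'M[C]_#|{: cfg N}|.
Definition op_mx N (f : cfg N -> cfg N -> C) : Op N :=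
  \matrix_(i, j) f (enum_val i) (enum_val j).

Definition adj m (X : 'M[C]_m) : 'M[C]_m := (map_mx (@conjc R) X)^T.

Definition opL (g : gT) : siteOp := site_mx (fun a b => (a == (g * b)%g)%:R).
Definition opM (chi : gT -> C) : siteOp := site_mx (fun a b => (a == b)%:R * chi a).

Definition agree_off N (V : {set edge N}) (a b : cfg N) : bool :=
  [forall e, (e \notin V) ==> (a e == b e)].

(* embedding B(H_e) -> B(H_e) (x) 1 *)
Definition emb N (e : edge N) (X : siteOp) : Op N :=
  op_mx (fun a b => (agree_off [set e] a b)%:R
                     * X (enum_rank (a e)) (enum_rank (b e))).

(* B(H_V) (x) 1_{Lambda \ V}: operators acting only on the edges in V *)
Definition restr N (V : {set edge N}) (a : cfg N) : cfg N :=
  [ffun e => if e \in V then a e else 1%g].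
Definition supported_in N (V : {set edge N}) (O : Op N) : Prop :=
  exists f : cfg N -> cfg N -> C,
    O = op_mx (fun a b => (agree_off V a b)%:R * f (restr V a) (restr V b)).

Definition chars : set {ffun gT -> C} :=
  [set chi | (forall g h, chi (g * h)%g = chi g * chi h) /\
             (forall g, `|chi g| = 1)].

Definition Astar_g N (s : vertex N) (g : gT) : Op N :=
  (\prod_(e in dplus s) emb e (opL g)) * (\prod_(e in dminus s) emb e (opL (g^-1)%g)).
Definition Bplaq_chi N (p : plaq N) (chi : {ffun gT -> C}) : Op N :=
  (\prod_(e in bplus p) emb e (opM chi)) *
  (\prod_(e in bminus p) emb e (opM (fun g => conjc (chi g)))).
Definition Astar N (s : vertex N) : Op N :=
  (#|{: gT}|%:R)^-1 *: \sum_(g : gT) Astar_g s g.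
Definition Bplaq N (p : plaq N) : Op N :=
  (#|{: gT}|%:R)^-1 *: \sum_(chi \in chars) Bplaq_chi p chi.

Definition Ham N (V : {set edge N}) : Op N :=
  - (\sum_(s in stars_of V) Astar s) - \sum_(p in plaqs_of V) Bplaq p.

Definition spec m (H : 'M[C]_m) : set C :=
  [set lam | exists v : 'cV[C]_m, v != 0 /\ H *m v = lam *: v].

Definition specproj m (H : 'M[C]_m) (lam : C) : 'M[C]_m :=
  xget 0 [set P : 'M[C]_m | [/\ adj P = P, P *m P = P &
           forall v : 'cV[C]_m, P *m v = v <-> H *m v = lam *: v]].

Definition bohr m (H : 'M[C]_m) : set R :=
  [set w | exists lam lam', [/\ spec H lam, spec H lam' & lam - lam' = (w%:C)%C]].

Definition freqcomp m (H : 'M[C]_m) (Q : 'M[C]_m) (w : R) : 'M[C]_m :=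
  \sum_(ll \in [set ll : C * C | [/\ spec H ll.1, spec H ll.2 & ll.1 - ll.2 = (w%:C)%C]])
     (specproj H ll.1 *m Q *m specproj H ll.2).

Definition davies_edge N (I : finType) (S : edge N -> I -> siteOp)
  (h : edge N -> I -> R -> R) (e : edge N) (O : Op N) : Op N :=
  let H := Ham [set: edge N] in
  \sum_(i : I) \sum_(w \in bohr H)
    let Sw := freqcomp H (emb e (S e i)) w in
    ((h e i w)%:C)%C *: (adj Sw *m O *m Sw
                     - 2%:R^-1 *: (adj Sw *m Sw *m O + O *m (adj Sw *m Sw))).

Definition davies N (I : finType) (S : edge N -> I -> siteOp)
  (h : edge N -> I -> R -> R) (V : {set edge N}) (O : Op N) : Op N :=
  \sum_(e in V) davies_edge S h e O.

End QD.

(* Main.v *)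
(** In the Heisenberg picture, [L(O) = 0] forces [O] to commute with every jump operator:
    for Hermitian [O] with eigenbasis [v_i] and eigenvalues [d_i], the [i]-th diagonal
    entry of [L(O)] is a sum of [r |K_ki|^2 (d_k - d_i)], and since the set of jump
    operators is closed under adjoints one can argue downwards from the largest
    eigenvalue.

    So [O] commutes with [S] and with [[H, S]], and by Jacobi [[O, H]] commutes with
    all [S]; irreducibility puts [O] and [[O, H]] in the commutant of the region.
    In the configuration basis the entries of [[O, H]] displaced by a gauge
    transformation come from one single [A_s(g)], whereas the contributions of the
    plaquettes are separated by the orthogonality of the characters of the region.
    Connectivity guarantees that distinct stars (plaquettes) restrict to distinct
    patterns on the region.  Conversely, [O] commutes with all iterated commutators of
    [H] with [S], whose span contains the frequency components by a Vandermonde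
    argument. *)

Require Import Defs.
From HB Require Import structures.
From mathcomp Require Import all_boot all_order all_algebra all_fingroup.
From mathcomp Require Import all_classical all_reals.
From mathcomp Require Import analysis.sequences analysis.exp.
From mathcomp Require Import complex.
From mathcomp Require Import finmap ring.
Import Order.TTheory GRing.Theory Num.Theory.
Local Open Scope ring_scope.

Set Implicit Arguments.
Unset Strict Implicit.
Unset Printing Implicit Defensive.

(** * Kernel of a dissipator *)

Section ConjugateTranspose.
Variables (C : numClosedFieldType) (m : nat).
Implicit Types X Y O : 'M[C]_m.

(** The adjoint over an abstract closed field; [adj_ctr] identifies it with [adj] when the scalars
    are [R[i]]. *)
Definition ctr X : 'M[C]_m := (map_mx Num.conj X)^T.

Lemma ctrE X i j : ctr X i j = (X j i)^*.
Proof. by rewrite !mxE. Qed.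

Lemma ctrK X : ctr (ctr X) = X.
Proof. by apply/matrixP => i j; rewrite !ctrE conjCK. Qed.

Lemma ctrM X Y : ctr (X *m Y) = ctr Y *m ctr X.
Proof. by rewrite /ctr map_mxM trmx_mul. Qed.

Lemma ctrD X Y : ctr (X + Y) = ctr X + ctr Y.
Proof. by rewrite /ctr map_mxD linearD. Qed.

Lemma ctrN X : ctr (- X) = - ctr X.
Proof. by rewrite /ctr map_mxN linearN. Qed.

Lemma ctrZ a X : ctr (a *: X) = a^* *: ctr X.
Proof. by rewrite /ctr map_mxZ linearZ. Qed.

Lemma ctr0 : ctr 0 = 0.
Proof. by rewrite /ctr map_mx0 trmx0. Qed.

Lemma ctr_sum (T : Type) (s : seq T) (P : pred T) (F : T -> 'M[C]_m) :
  ctr (\sum_(t <- s | P t) F t) = \sum_(t <- s | P t) ctr (F t).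
Proof. exact: (big_morph _ ctrD ctr0). Qed.

(** The spectral theorem; the columns of [ctr U] form the orthonormal eigenbasis. *)
Lemma hermitian_diagonalizable X : ctr X = X ->
  exists (U : 'M[C]_m) (d : 'I_m -> C),
    [/\ U *m ctr U = 1%:M, ctr U *m U = 1%:M, forall i, d i \is Num.real &
        X = ctr U *m diag_mx (\row_i d i) *m U].
Proof.
move=> hX.
have Xh : X \is hermsymmx.
  apply/is_hermitianmxP; rewrite expr0 scale1r -[LHS]hX.
  by apply/matrixP => i j; rewrite !mxE.
have Xn := hermitian_normalmx Xh.
have Uu := spectral_unitarymx X.
have dR := hermitian_spectral_diag_real Xh.
have eadj : ctr (spectralmx X) = invmx (spectralmx X).
  by rewrite invmx_unitary //; apply/matrixP => i j; rewrite !mxE.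
exists (spectralmx X), (fun i => spectral_diag X 0 i).
rewrite eadj mulmxV ?mulVmx ?spectral_unit //; split=> //.
  by move=> i; have /mxOverP := dR; apply.
rewrite [LHS](orthomx_spectralP Xn).
by congr (_ *m diag_mx _ *m _); apply/rowP => i; rewrite mxE.
Qed.

End ConjugateTranspose.

Section Dissipator.
Variables (C : numClosedFieldType) (m : nat) (T : eqType).
Implicit Types (s : seq T) (r : T -> C) (K : T -> 'M[C]_m) (O : 'M[C]_m).

(** A Lindblad generator over one flat list, so that edge, jump operator and Bohr frequency can
    later be packed into a single label [t]. *)
Definition dissipator s r K O : 'M[C]_m :=
  \sum_(t <- s) r t *:
    (ctr (K t) *m O *m K t
     - 2%:R^-1 *: (ctr (K t) *m K t *m O + O *m (ctr (K t) *m K t))).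

Lemma dissipatorD s r K O1 O2 :
  dissipator s r K (O1 + O2) = dissipator s r K O1 + dissipator s r K O2.
Proof.
rewrite -big_split; apply: eq_bigr => t _ /=.
rewrite -scalerDr; congr (_ *: _).
rewrite !mulmxDr !mulmxDl [RHS]addrACA -opprD -scalerDr.
by congr (_ - _ *: _); rewrite addrACA.
Qed.

Lemma dissipatorZ s r K a O : dissipator s r K (a *: O) = a *: dissipator s r K O.
Proof.
rewrite scaler_sumr; apply: eq_bigr => t _.
rewrite scalerA mulrC -scalerA; congr (_ *: _).
rewrite -!scalemxAr -!scalemxAl -scalerDr !scalerBr.
by rewrite !scalerA mulrC.
Qed.

Lemma dissipator_adj s r K O : (forall t, t \in s -> 0 < r t) ->
  dissipator s r K (ctr O) = ctr (dissipator s r K O).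
Proof.
move=> r_gt0; rewrite /dissipator ctr_sum big_seq [RHS]big_seq; apply: eq_bigr => t /r_gt0/gtr0_real/CrealP rR.
rewrite ctrZ ctrD ctrN ctrZ ctrD !ctrM !ctrK rR fmorphV rmorph_nat.
rewrite !mulmxA; congr (_ *: (_ - _ *: _)).
exact: (addrC (_ *m _) (_ *m _)).
Qed.

(** A unitary change of basis only conjugates the jump operators, which reduces Hermitian [O] to
    diagonal [O]. *)
Lemma dissipator_conj s r K U O : U *m ctr U = 1%:M -> ctr U *m U = 1%:M ->
  dissipator s r K (ctr U *m O *m U)
  = ctr U *m dissipator s r (fun t => U *m K t *m ctr U) O *m U.
Proof.
move=> UU' U'U; rewrite mulmx_sumr mulmx_suml; apply: eq_bigr => t _.
rewrite -scalemxAr -scalemxAl; congr (_ *: _).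
rewrite mulmxDr mulmxDl mulmxN mulNmx -scalemxAr -scalemxAl.
rewrite mulmxDr mulmxDl !ctrM ctrK !mulmxA U'U !mul1mx.
have e X Y : X *m ctr U *m U *m Y = X *m Y by rewrite -(mulmxA X) U'U mulmx1.
have e' X : X *m ctr U *m U = X by rewrite -(mulmxA X) U'U mulmx1.
by rewrite !(e, e').
Qed.

(** Column [i] of [K t] weighs [d k] in the gain term and [d i] in the loss term, whose two halves
    coincide on the diagonal. *)
Lemma dissipator_diag_entry s r K (d : 'I_m -> C) i :
  dissipator s r K (diag_mx (\row_i d i)) i i
  = \sum_(t <- s) r t * \sum_k `|K t k i| ^+ 2 * (d k - d i).
Proof.
rewrite summxE; apply: eq_bigr => t _.
rewrite !mul_mx_diag !mul_diag_mx [LHS]mxE; congr (_ * _).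
rewrite !mxE.
pose s1 := \sum_k ((K t k i)^* * K t k i).
have -> : \sum_j ctr (K t) i j * K t j i = s1 by apply: eq_bigr => k _; rewrite ctrE.
rewrite (mulrC s1) -mulr2n -[_ * s1 *+ 2]mulr_natl mulKf ?pnatr_eq0 // mulr_sumr -sumrB.
apply: eq_bigr => k _; rewrite !mxE normCK mulrBr (mulrC (K t k i)).
by rewrite (mulrC (d i)) (mulrAC _ (d k)).
Qed.

(* Since the diagonal entries above are positively weighted sums of [d k - d i],
   the claim follows by induction on the number of levels above [d i]. *)
Lemma dissipator_diag_kernel s r K (d : 'I_m -> C) :
  (forall i, d i \is Num.real) ->
  (forall t, t \in s -> 0 < r t) ->
  (forall t, t \in s -> exists2 t', t' \in s & K t' = ctr (K t)) ->
  dissipator s r K (diag_mx (\row_i d i)) = 0 ->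
  forall t i k, t \in s -> K t k i != 0 -> d k = d i.
Proof.
move=> dR r_gt0 Kadj D0.
have D0i i : \sum_(t <- s) r t * \sum_k `|K t k i| ^+ 2 * (d k - d i) = 0.
  by rewrite -dissipator_diag_entry D0 mxE.
suff main n i : (#|[pred j | (d i < d j)%R]| < n)%N ->
    forall t k, t \in s -> K t k i != 0 -> d k = d i.
  by move=> t i k; apply: main.
elim: n i => // n IH i; rewrite ltnS => lei.
(* An entry from [i] up to a higher level [k] is conjugate to an entry of the adjoint jump in column
   [k]. Fewer levels lie above [d k], so the induction hypothesis applies there and rules the entry
   out. *)
have above t k : t \in s -> d i < d k -> K t k i = 0.
  move=> ts dik; have [t' t's Kt'] := Kadj t ts.
  apply/eqP/negP => /negP Kn0.
  suff /eqP : d i = d k by rewrite lt_eqF.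
  apply: (IH k _ t' i t's); last by rewrite Kt' ctrE conjC_eq0.
  apply: leq_trans lei; apply: proper_card; apply/properP; split.
    by apply/fintype.subsetP => j; rewrite !inE; apply: lt_trans.
  by exists k; rewrite !inE ?ltxx.
have term_le t k : t \in s -> `|K t k i| ^+ 2 * (d k - d i) <= 0.
  move=> ts; have [dik|dki] := real_ltP (dR i) (dR k).
    by rewrite above // normr0 expr0n mul0r.
  by rewrite mulr_ge0_le0 ?subr_le0 ?exprn_ge0.
move=> t k ts; apply: contraNeq => dki; apply/eqP.
(* With the upward entries gone every summand is nonpositive, so the vanishing total forces first
   each jump's term and then each single entry to vanish. *)
have sum_le u : u \in s -> r u * \sum_k `|K u k i| ^+ 2 * (d k - d i) <= 0.
  move=> us; apply: mulr_ge0_le0; first exact/ltW/r_gt0.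
  by apply: sumr_le0 => j _; apply: term_le.
have t0 : r t * \sum_k `|K t k i| ^+ 2 * (d k - d i) = 0.
  apply/eqP; rewrite eq_le sum_le //= -[X in X <= _](D0i i) (big_rem t ts) /= gerDl.
  by rewrite big_seq sumr_le0 // => u /mem_rem; apply: sum_le.
move/eqP: t0; rewrite mulf_eq0 gt_eqF ?r_gt0 //= => /eqP t0.
have : `|K t k i| ^+ 2 * (d k - d i) = 0.
  apply/eqP; rewrite eq_le term_le //= -[X in X <= _]t0 (bigD1 k) //= gerDl.
  by apply: sumr_le0 => j _; apply: term_le.
move/eqP; rewrite mulf_eq0 [X in _ || X]subr_eq0 (negPf dki) orbF.
by rewrite expf_eq0 /= normr_eq0 => /eqP.
Qed.

(** The diagonal case transfers to Hermitian [O] by diagonalisation, and to general [O] because the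
    kernel is closed under adjoints and so contains both Hermitian parts of [O]. *)
Lemma dissipator_kernel s r K O :
  (forall t, t \in s -> 0 < r t) ->
  (forall t, t \in s -> exists2 t', t' \in s & K t' = ctr (K t)) ->
  dissipator s r K O = 0 <-> forall t, t \in s -> O *m K t = K t *m O.
Proof.
move=> r_gt0 Kadj.
have half (X : 'M[C]_m) : 2%:R^-1 *: (X + X) = X.
  by rewrite -[X in X + X]scale1r -scalerDl scalerA -[1 + 1]/2%:R mulVf ?pnatr_eq0 ?scale1r.
split; last first.
  move=> cK; rewrite /dissipator big_seq big1 // => t ts.
  have [t' t's Kt'] := Kadj t ts; have cK' := cK t' t's; rewrite Kt' in cK'.
  rewrite -mulmxA (cK t ts) !mulmxA cK' -(mulmxA _ O) (cK t ts) mulmxA.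
  by rewrite half subrr scaler0.
have herm Q : ctr Q = Q -> dissipator s r K Q = 0 ->
    forall t, t \in s -> Q *m K t = K t *m Q.
  move=> hQ; have [U [d [UU' U'U dR ->]]] := hermitian_diagonalizable hQ.
  rewrite dissipator_conj // => D0 t ts.
  have D0' : dissipator s r (fun t => U *m K t *m ctr U) (diag_mx (\row_i0 d i0)) = 0.
    move/(congr1 (fun Y => U *m Y *m ctr U)): D0.
    by rewrite !mulmxA UU' mul1mx -mulmxA UU' mulmx1 mulmx0 mul0mx.
  have Kd : diag_mx (\row_i0 d i0) *m (U *m K t *m ctr U)
          = (U *m K t *m ctr U) *m diag_mx (\row_i0 d i0).
    rewrite mul_mx_diag mul_diag_mx; apply/matrixP => k i; rewrite !mxE.
    set x := (\sum_j _); have [->|xn0] := eqVneq x 0; first by rewrite mulr0 mul0r.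
    rewrite mulrC; congr (_ * _).
    apply: (dissipator_diag_kernel dR r_gt0 _ D0' ts); last by rewrite mxE.
    move=> u us; have [u' u's e] := Kadj u us.
    by exists u' => //; rewrite !ctrM ctrK e mulmxA.
  move/(congr1 (fun Y => ctr U *m Y *m U)): Kd.
  by rewrite -!mulmxA U'U mulmx1 !mulmxA U'U mul1mx.
move=> D0 t ts.
(* The Hermitian and anti-Hermitian parts, scaled so that both [A] and [B] are Hermitian and
   [O = A + 'i *: B]. *)
pose A := 2%:R^-1 *: (O + ctr O); pose B := (2%:R^-1 * 'i) *: (ctr O - O).
have D0' : dissipator s r K (ctr O) = 0 by rewrite dissipator_adj // D0 ctr0.
have OE : O = A + 'i *: B.
  rewrite /A /B scalerA mulrCA -expr2 sqrCi mulrN1 scaleNr -scalerN opprB.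
  by rewrite -scalerDr addrACA subrr addr0 half.
have DA : dissipator s r K A = 0.
  by rewrite dissipatorZ dissipatorD D0 D0' addr0 scaler0.
have DB : dissipator s r K B = 0.
  by rewrite dissipatorZ -scaleN1r dissipatorD dissipatorZ D0 D0' scaler0 addr0 scaler0.
have hA : ctr A = A by rewrite ctrZ ctrD ctrK fmorphV rmorph_nat addrC.
have hB : ctr B = B.
  rewrite ctrZ ctrD ctrN ctrK rmorphM /= fmorphV rmorph_nat conjCi.
  by rewrite mulrN scaleNr -scalerN opprB.
have cA := herm A hA DA t ts; have cB := herm B hB DB t ts.
by rewrite OE mulmxDl mulmxDr cA -['i *: B *m _]scalemxAl cB scalemxAr.
Qed.

End Dissipator.

(** * Spectral decomposition and Bohr frequencies *)

Section SpectralProjection.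
Variables (C : numClosedFieldType) (m : nat) (U : 'M[C]_m) (d : 'I_m -> C).
Hypotheses (UU' : U *m ctr U = 1%:M) (U'U : ctr U *m U = 1%:M).
Let H := ctr U *m diag_mx (\row_i d i) *m U.

Definition level_mx l : 'M[C]_m := diag_mx (\row_i (d i == l)%:R).
Definition level_proj l : 'M[C]_m := ctr U *m level_mx l *m U.

Lemma level_proj_adj l : ctr (level_proj l) = level_proj l.
Proof.
rewrite !ctrM ctrK mulmxA; congr (_ *m _ *m _).
apply/matrixP => i j; rewrite ctrE !mxE (eq_sym j).
by case: (eqVneq i j) => [->|_]; rewrite ?mulr1n ?mulr0n ?rmorph0 ?rmorph_nat.
Qed.

Lemma level_proj_idem l : level_proj l *m level_proj l = level_proj l.
Proof.
rewrite /level_proj -!mulmxA; congr (_ *m _).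
rewrite (mulmxA U) UU' mul1mx mulmxA; congr (_ *m _).
by rewrite mulmx_diag; congr diag_mx; apply/rowP => i; rewrite !mxE -natrM mulnb andbb.
Qed.

Lemma conj_vec_eq (A B : 'M[C]_m) (v : 'cV[C]_m) :
  ctr U *m A *m U *m v = ctr U *m B *m U *m v <-> A *m (U *m v) = B *m (U *m v).
Proof.
split=> e; last by rewrite -!mulmxA e.
have := congr1 (mulmx U) e.
by rewrite !mulmxA UU' !mul1mx.
Qed.

Lemma level_mx_eigen l (u : 'cV[C]_m) :
  level_mx l *m u = u <-> diag_mx (\row_i d i) *m u = l *: u.
Proof.
rewrite !mul_diag_mx; split=> /matrixP e; apply/matrixP => i j; move: (e i j); rewrite !mxE;
  case: eqVneq => [->|nl]; rewrite ?mul1r ?mul0r //.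
  by move=> <-; rewrite !mulr0.
by move/eqP; rewrite -subr_eq0 -mulrBl mulf_eq0 subr_eq0 (negPf nl) => /eqP ->.
Qed.

Lemma level_proj_eigen l (v : 'cV[C]_m) :
  level_proj l *m v = v <-> H *m v = l *: v.
Proof.
have e1 : v = ctr U *m 1%:M *m U *m v by rewrite mulmx1 U'U mul1mx.
have e2 : l *: v = ctr U *m l%:M *m U *m v.
  by rewrite -!mulmxA mul_scalar_mx -scalemxAr mulmxA U'U mul1mx.
rewrite e2 [X in _ = X <-> _]e1 /level_proj /H !conj_vec_eq mul1mx mul_scalar_mx.
exact: level_mx_eigen.
Qed.

(** Two orthogonal projections with the same fixed vectors absorb each other, and taking adjoints
    reverses the order of the product. This pins down the choice made in [specproj]. *)
Lemma level_proj_uniq l (P : 'M[C]_m) :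
  ctr P = P -> P *m P = P ->
  (forall v : 'cV[C]_m, P *m v = v <-> H *m v = l *: v) -> P = level_proj l.
Proof.
move=> hP PP fixP.
have absorb (A B : 'M[C]_m) : B *m B = B ->
    (forall v : 'cV[C]_m, B *m v = v -> A *m v = v) -> A *m B = B.
  move=> BB AB; apply/matrixP => i j.
  have /(congr1 (fun v : 'cV[C]_m => v i 0)) : A *m (B *m delta_mx j (0 : 'I_1)) = B *m delta_mx j 0.
    by apply: AB; rewrite mulmxA BB.
  by rewrite mulmxA -!colE !mxE.
have e1 : P *m level_proj l = level_proj l.
  apply: absorb; first exact: level_proj_idem.
  by move=> v /level_proj_eigen /fixP.
have e2 : level_proj l *m P = P.
  apply: (absorb _ _ PP) => v Pv.
  exact: (proj2 (level_proj_eigen l v) (proj1 (fixP v) Pv)).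
by rewrite -[RHS]level_proj_adj -e1 ctrM level_proj_adj hP e2.
Qed.

Lemma eigenvalue_level l :
  (exists v : 'cV[C]_m, v != 0 /\ H *m v = l *: v) <-> exists i, l = d i.
Proof.
split=> [[v [vn0 Hv]]|[i ->]].
  have un0 : U *m v != 0.
    apply: contraNneq vn0 => e; apply/eqP.
    by rewrite -[v]mul1mx -U'U -mulmxA e mulmx0.
  have [i ui] : exists i, (U *m v) i 0 != 0.
    apply/existsP; apply: contraNT un0; rewrite negb_exists => /forallP u0.
    by apply/eqP/matrixP => i j; rewrite ord1 [RHS]mxE; apply/eqP; move: (u0 i); rewrite negbK.
  exists i; have := congr1 (fun w => (U *m w) i 0) Hv.
  rewrite /H !mulmxA UU' mul1mx -mulmxA mul_diag_mx -scalemxAr [LHS]mxE [RHS]mxE [X in X * _]mxE.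
  by move/(mulIf ui).
exists (ctr U *m delta_mx i 0); split.
  apply/eqP => e; have := congr1 (fun w => (U *m w) i 0) e.
  rewrite mulmxA UU' mul1mx mulmx0 !mxE !eqxx => /eqP.
  by rewrite oner_eq0.
rewrite /H -!mulmxA (mulmxA U) UU' mul1mx scalemxAr; congr (_ *m _).
rewrite mul_diag_mx; apply/matrixP => k j; rewrite !mxE.
by case: eqVneq => [->|]; rewrite ?mulr0.
Qed.

(** A mask in the eigenbasis: the entries whose pair of eigenvalues satisfies [p] are kept.
    Frequency components are such masks. *)
Definition level_block (p : C -> C -> bool) (Q : 'M[C]_m) : 'M[C]_m :=
  ctr U *m (\matrix_(j, k) (if p (d j) (d k) then (U *m Q *m ctr U) j k else 0)) *m U.

Lemma eq_level_block (p q : C -> C -> bool) (Q : 'M[C]_m) :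
  (forall j k, p (d j) (d k) = q (d j) (d k)) -> level_block p Q = level_block q Q.
Proof.
by move=> pq; congr (_ *m _ *m _); apply/matrixP => j k; rewrite !mxE pq.
Qed.

Lemma sum_level_proj (s : seq (C * C)) (Q : 'M[C]_m) : uniq s ->
  \sum_(ll <- s) (level_proj ll.1 *m Q *m level_proj ll.2)
  = level_block (fun x y => (x, y) \in s) Q.
Proof.
move=> us; rewrite /level_block.
under eq_bigr => ll _.
  have -> : level_proj ll.1 *m Q *m level_proj ll.2
    = ctr U *m (level_mx ll.1 *m (U *m Q *m ctr U) *m level_mx ll.2) *m U.
    by rewrite /level_proj !mulmxA.
  over.
rewrite -mulmx_suml -mulmx_sumr; congr (_ *m _ *m _).
apply/matrixP => j k; rewrite summxE [RHS]mxE.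
have term ll : (level_mx ll.1 *m (U *m Q *m ctr U) *m level_mx ll.2) j k
    = if ll == (d j, d k) then (U *m Q *m ctr U) j k else 0.
  move: (U *m Q *m ctr U) => Q'.
  rewrite mul_mx_diag mul_diag_mx !mxE; case: ll => a b /=.
  rewrite xpair_eqE (eq_sym a) (eq_sym b).
  by do 2!case: eqP => _; rewrite ?(mul1r, mul0r, mulr1, mulr0).
rewrite (eq_bigr _ (fun ll _ => term ll)); case: ifPn => [ds|nds].
  by rewrite (bigD1_seq _ ds us) /= eqxx big1 ?addr0 // => ll /negPf ->.
by rewrite big_seq big1 // => ll lls; case: eqP lls nds => // -> ->.
Qed.

Lemma level_block_adj p (Q : 'M[C]_m) :
  ctr (level_block p Q) = level_block (fun x y => p y x) (ctr Q).
Proof.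
rewrite !ctrM ctrK mulmxA; congr (_ *m _ *m _).
apply/matrixP => j k; rewrite ctrE [in LHS]mxE [RHS]mxE.
have -> : U *m ctr Q *m ctr U = ctr (U *m Q *m ctr U) by rewrite !ctrM ctrK mulmxA.
by rewrite ctrE; case: ifP => // _; rewrite conjC0.
Qed.

(** In the eigenbasis, commuting with [H] multiplies the entry at [j], [k] by [d j - d k], which is
    [w] wherever the mask is on. *)
Lemma level_block_comm (p : C -> C -> bool) w (Q : 'M[C]_m) : (forall x y, p x y -> x - y = w) ->
  H *m level_block p Q - level_block p Q *m H = w *: level_block p Q.
Proof.
move=> pw; rewrite /H /level_block.
set X := \matrix_(_, _) _.
rewrite -!mulmxA (mulmxA U) (mulmxA U (ctr U)) UU' !mul1mx !mulmxA.
rewrite -mulmxBl scalemxAl; congr (_ *m _).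
rewrite -!mulmxA -mulmxBr scalemxAr; congr (_ *m _).
rewrite mul_mx_diag mul_diag_mx; apply/matrixP => j k; rewrite !mxE.
case: ifP => [/pw <-|_]; last by rewrite !(mulr0, mul0r) subrr.
by rewrite mulrBl [X in _ - X]mulrC.
Qed.

Lemma sum_level_block (T : Type) (s : seq T) (p : T -> C -> C -> bool) (Q : 'M[C]_m) :
  (forall j k, \sum_(w <- s) (p w (d j) (d k))%:R = 1 :> C) ->
  \sum_(w <- s) level_block (p w) Q = Q.
Proof.
move=> p1; rewrite /level_block -mulmx_suml -mulmx_sumr.
have -> : \sum_(w <- s) (\matrix_(j, k) (if p w (d j) (d k) then (U *m Q *m ctr U) j k else 0))
   = U *m Q *m ctr U.
  apply/matrixP => j k; rewrite summxE -[RHS]mul1r -(p1 j k) mulr_suml.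
  by apply: eq_bigr => w _; rewrite mxE; case: ifP; rewrite ?mul1r ?mul0r.
by rewrite !mulmxA U'U mul1mx -mulmxA U'U mulmx1.
Qed.

End SpectralProjection.

Section BohrFrequencies.
Variables (R : realType) (m : nat).
Local Notation C := (R[i]).

Lemma real_complexN (w : R) : ((- w)%:C)%C = - (w%:C)%C :> C.
Proof. exact: rmorphN. Qed.

Lemma adj_ctr (X : 'M[C]_m) : adj X = ctr X.
Proof. by apply/matrixP => i j; rewrite !mxE. Qed.

Section Diagonalized.
Variables (U H : 'M[C]_m) (d : 'I_m -> C).
Hypotheses (UU' : U *m ctr U = 1%:M) (U'U : ctr U *m U = 1%:M).
Hypothesis dR : forall i, d i \is Num.real.
Hypothesis HE : H = ctr U *m diag_mx (\row_i d i) *m U.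

Lemma specE l : spec H l <-> exists i, l = d i.
Proof. by rewrite /spec /= HE; exact: (eigenvalue_level d UU' U'U l). Qed.

Lemma spec_seq l : spec H l <-> l \in [seq d i | i <- enum 'I_m].
Proof.
rewrite specE; split=> [[i ->]|/mapP[i _ ->]]; last by exists i.
by apply/mapP; exists i => //; rewrite mem_enum.
Qed.

Lemma finite_spec : finite_set (spec H).
Proof.
apply: (sub_finite_set _ (finite_seq [seq d i | i <- enum 'I_m])) => l.
by rewrite /= -spec_seq.
Qed.

(** [level_proj] inhabits the set from which [specproj] chooses, so [xget] does not fall back on its
    default [0], and uniqueness identifies the choice. *)
Lemma specprojE l : specproj H l = level_proj U d l.
Proof.
have P0 : [set P : 'M[C]_m | [/\ adj P = P, P *m P = P &
           forall v : 'cV[C]_m, P *m v = v <-> H *m v = l *: v]]%classic (level_proj U d l).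
  split; first exact: (etrans (adj_ctr _) (level_proj_adj U d l)).
    exact: (level_proj_idem d UU' l).
  by move=> v; rewrite HE; exact: (level_proj_eigen d UU' U'U l v).
have [hP PP fixP] : [/\ adj (specproj H l) = specproj H l,
    specproj H l *m specproj H l = specproj H l &
    forall v : 'cV[C]_m, specproj H l *m v = v <-> H *m v = l *: v].
  exact: (xgetPex 0 (ex_intro _ _ P0)).
rewrite adj_ctr in hP; apply: (level_proj_uniq UU' U'U hP PP) => v.
by rewrite -HE; exact: fixP.
Qed.

Lemma freqcompE Q w :
  freqcomp H Q w = level_block U d (fun x y => x - y == (w%:C)%C) Q.
Proof.
set A := [set ll : C * C | [/\ spec H ll.1, spec H ll.2 & ll.1 - ll.2 = (w%:C)%C]]%classic.
have finA : finite_set A.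
  apply: (sub_finite_set _ (finite_setX finite_spec finite_spec)) => ll [? ? _] //.
rewrite /freqcomp -/A (fsbig_finite _ _ finA).
under eq_bigr do rewrite !specprojE.
rewrite sum_level_proj; last exact: fset_uniq.
apply: eq_level_block => j k; rewrite in_fset_set //; apply/idP/eqP.
  by move/set_mem => -[].
by move=> e; apply/mem_set; split=> //=; apply/specE; [exists j|exists k].
Qed.

Lemma bohrE w : bohr H w <-> exists j k, d j - d k = (w%:C)%C.
Proof.
split=> [[l [l' [/specE[j ->] /specE[k ->] e]]]|[j [k e]]]; first by exists j, k.
by exists (d j), (d k); split=> //; apply/specE; [exists j|exists k].
Qed.

Lemma level_diff_real j k : d j - d k = ((complex.Re (d j - d k))%:C)%C.
Proof. by rewrite RRe_real // rpredB. Qed.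

Lemma finite_bohr_diag : finite_set (bohr H).
Proof.
apply: (sub_finite_set _ (finite_seq [seq complex.Re (d jk.1 - d jk.2) | jk <- enum [set: 'I_m * 'I_m]])).
move=> w /bohrE[j [k e]] /=; apply/mapP; exists (j, k); first by rewrite mem_enum inE.
by rewrite /= e.
Qed.

End Diagonalized.

Variable H : 'M[C]_m.
Hypothesis hH : adj H = H.

Lemma finite_bohr : finite_set (bohr H).
Proof.
have := hH; rewrite adj_ctr => /hermitian_diagonalizable[U [d [UU' U'U dR HE]]].
exact: finite_bohr_diag UU' U'U HE.
Qed.

Lemma bohrN w : bohr H w -> bohr H (- w).
Proof.
by move=> [l [l' [sl sl' e]]]; exists l', l; split=> //; rewrite real_complexN -e opprB.
Qed.

Lemma freqcomp_adj Q w : adj (freqcomp H Q w) = freqcomp H (adj Q) (- w).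
Proof.
have := hH; rewrite !adj_ctr => /hermitian_diagonalizable[U [d [UU' U'U dR HE]]].
rewrite !(freqcompE UU' U'U HE) level_block_adj.
by apply: eq_level_block => j k; rewrite real_complexN -eqr_oppLR opprB.
Qed.

Lemma sum_freqcomp Q : \sum_(w <- fset_set (bohr H)) freqcomp H Q w = Q.
Proof.
have := hH; rewrite adj_ctr => /hermitian_diagonalizable[U [d [UU' U'U dR HE]]].
under eq_bigr do rewrite (freqcompE UU' U'U HE).
apply: sum_level_block => // j k; rewrite (level_diff_real dR).
(* Differences of levels are real, so the pair [j], [k] is caught by exactly one Bohr frequency,
   [w0]. *)
set w0 := complex.Re _.
rewrite (bigD1_seq w0) ?fset_uniq //=; last first.
  rewrite in_fset_set; last exact: finite_bohr_diag UU' U'U HE.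
  by apply/mem_set/(bohrE UU' U'U HE); exists j, k; rewrite (level_diff_real dR).
rewrite eqxx big1 ?addr0 // => w /negPf nw.
by rewrite (inj_eq (@complexI R)) eq_sym nw.
Qed.

Lemma freqcomp_comm Q w :
  H *m freqcomp H Q w - freqcomp H Q w *m H = (w%:C)%C *: freqcomp H Q w.
Proof.
have := hH; rewrite adj_ctr => /hermitian_diagonalizable[U [d [UU' U'U dR HE]]].
rewrite !(freqcompE UU' U'U HE) HE.
by apply: (level_block_comm d UU') => x y /eqP.
Qed.

End BohrFrequencies.

(** * Operators on configurations *)

Section Entries.
Variables (R : realType) (gT : finGroupType) (N : nat).
Local Notation C := (R[i]).
Local Notation cfg := (cfg gT N).
Local Notation Op := (Op R gT N).
Local Notation siteOp := (siteOp R gT).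
Implicit Types (a b c : cfg) (X Y O : Op) (e : edge N).

Definition ent X a b : C := X (enum_rank a) (enum_rank b).
Definition sent (X : siteOp) (g h : gT) : C := X (enum_rank g) (enum_rank h).

Lemma entP X Y : (forall a b, ent X a b = ent Y a b) -> X = Y.
Proof.
move=> XY; apply/matrixP => i j.
by have := XY (enum_val i) (enum_val j); rewrite /ent !enum_valK.
Qed.

Lemma ent_op_mx (f : cfg -> cfg -> C) a b : ent (op_mx f) a b = f a b.
Proof. by rewrite /ent mxE !enum_rankK. Qed.

Lemma sent_site_mx (f : gT -> gT -> C) g h : sent (site_mx f) g h = f g h.
Proof. by rewrite /sent mxE !enum_rankK. Qed.

Lemma ent_mul X Y a b : ent (X *m Y) a b = \sum_c ent X a c * ent Y c b.
Proof.
rewrite /ent mxE (reindex (@enum_rank cfg)) //=.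
by exists enum_val => i _; rewrite ?enum_rankK ?enum_valK.
Qed.

Lemma sent_mul (X Y : siteOp) g h : sent (X *m Y) g h = \sum_k sent X g k * sent Y k h.
Proof.
rewrite /sent mxE (reindex (@enum_rank gT)) //=.
by exists enum_val => i _; rewrite ?enum_rankK ?enum_valK.
Qed.

Lemma entD X Y a b : ent (X + Y) a b = ent X a b + ent Y a b.
Proof. by rewrite /ent mxE. Qed.

Lemma entN X a b : ent (- X) a b = - ent X a b.
Proof. by rewrite /ent mxE. Qed.

Lemma entZ k X a b : ent (k *: X) a b = k * ent X a b.
Proof. by rewrite /ent mxE. Qed.

Lemma ent0 a b : ent 0 a b = 0.
Proof. by rewrite /ent mxE. Qed.

Lemma ent_sum (T : Type) (s : seq T) (P : pred T) (F : T -> Op) a b :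
  ent (\sum_(t <- s | P t) F t) a b = \sum_(t <- s | P t) ent (F t) a b.
Proof. by rewrite /ent summxE. Qed.

Lemma ent_adj X a b : ent (adj X) a b = conjc (ent X b a).
Proof. by rewrite /ent !mxE. Qed.

Lemma ent_emb e (X : siteOp) a b :
  ent (emb e X) a b = (agree_off [set e] a b)%:R * sent X (a e) (b e).
Proof. exact: ent_op_mx. Qed.

Lemma agree_offC (V : {set edge N}) a b : agree_off V a b = agree_off V b a.
Proof. by apply: eq_forallb => e; rewrite eq_sym. Qed.

Lemma emb_adj e (X : siteOp) : adj (emb e X) = emb e (adj X).
Proof.
apply: entP => a b; rewrite ent_adj !ent_emb agree_offC.
transitivity (conjc ((agree_off [set e] a b)%:R : C) * conjc (sent X (b e) (a e))).
  exact: rmorphM.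
by rewrite conjc_nat /sent !mxE.
Qed.

End Entries.

(** * The kernel of the Davies generator as a commutant *)

Section DaviesKernel.
Variables (R : realType) (gT : finGroupType) (N : nat) (I : finType).
Variables (S : edge N -> I -> siteOp R gT) (h : edge N -> I -> R -> R).
Hypothesis S_adj : forall e i, exists j, S e j = adj (S e i).
Hypothesis h_gt0 : forall e i w, 0 < h e i w.
Let H := Ham R gT [set: edge N].
Hypothesis hH : adj H = H.

Let jump (t : edge N * I * R) := freqcomp H (emb t.1.1 (S t.1.1 t.1.2)) t.2.
Let rate (t : edge N * I * R) : R[i] := ((h t.1.1 t.1.2 t.2)%:C)%C.
Let indices (V : {set edge N}) : seq (edge N * I * R) :=
  [seq (p, w) | p <- enum [set q : edge N * I | q.1 \in V], w <- fset_set (bohr H)].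

Lemma davies_dissipator (V : {set edge N}) O :
  davies S h V O = dissipator (indices V) rate jump O.
Proof.
rewrite /davies /davies_edge (eq_bigr _ (fun e _ => eq_bigr _ (fun i _ => fsbig_finite _ _ (finite_bohr hH)))) -/H.
rewrite pair_big_dep /= /dissipator /indices big_allpairs big_enum /=.
apply: eq_big => [[e i]|[e i] _]; first by rewrite inE andbT.
by apply: eq_bigr => w _; rewrite -adj_ctr.
Qed.

Lemma davies_kernel (V : {set edge N}) O :
  davies S h V O = 0 <->
  forall e i w, e \in V -> bohr H w ->
    O *m freqcomp H (emb e (S e i)) w = freqcomp H (emb e (S e i)) w *m O.
Proof.
have mem_indices t : t \in indices V <-> t.1.1 \in V /\ bohr H t.2.
  case: t => -[e i] w; rewrite /indices; split=> /=.
    case/allpairsP => -[[e' i'] w'] [/= + + [-> _ ->]].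
    rewrite mem_enum inE /= => eV; rewrite in_fset_set; last exact: finite_bohr.
    by move/set_mem.
  case=> eV wb; apply/allpairsP; exists ((e, i), w) => /=; split=> //.
    by rewrite mem_enum inE.
  by rewrite in_fset_set; [exact/mem_set | exact: finite_bohr].
rewrite davies_dissipator dissipator_kernel.
- split=> [cO e i w eV wb | cO t /mem_indices[]]; last exact: cO.
  by apply: (cO (e, i, w)); apply/mem_indices.
- by move=> t _; rewrite /rate ltcR h_gt0.
(* The family of jumps is closed under adjoints: the adjoint of a component at [w] is a component at
   [- w] of the adjoint bare jump. *)
- move=> [[e i] w] /mem_indices[/= eV wb].
  have [j Sj] := S_adj e i; exists (e, j, - w).
    by apply/mem_indices; split=> //=; apply: bohrN.
  by rewrite /jump /= -adj_ctr freqcomp_adj // Sj emb_adj.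
Qed.

End DaviesKernel.

(** * Operators supported away from a region *)

Section Support.
Variables (R : realType) (gT : finGroupType) (N : nat).
Local Notation C := (R[i]).
Local Notation cfg := (cfg gT N).
Local Notation Op := (Op R gT N).
Local Notation siteOp := (siteOp R gT).
Implicit Types (a b c : cfg) (X Y O : Op) (e : edge N) (V : {set edge N}).

Definition cmul a b : cfg := [ffun e => (a e * b e)%g].
Definition cinv a : cfg := [ffun e => ((a e)^-1)%g].
Definition cone : cfg := [ffun => 1%g].
Definition upd a e (g : gT) : cfg := [ffun e' => if e' == e then g else a e'].
Definition single e (g : gT) : cfg := [ffun e' => if e' == e then g else 1%g].
Definition trivial_off V c := forall e, e \notin V -> c e = 1%g.
Definition agree_on V a b := [forall e in V, a e == b e].

Lemma agree_onP V a b : reflect (forall e, e \in V -> a e = b e) (agree_on V a b).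
Proof. by apply: (iffP forall_inP) => ab e /ab /eqP. Qed.

Lemma cmulA : associative cmul.
Proof. by move=> a b c; apply/ffunP => e; rewrite !ffunE mulgA. Qed.
Lemma cmul1c : left_id cone cmul.
Proof. by move=> a; apply/ffunP => e; rewrite !ffunE mul1g. Qed.
Lemma cmulVc : left_inverse cone cinv cmul.
Proof. by move=> a; apply/ffunP => e; rewrite !ffunE mulVg. Qed.
Lemma cmulcV : right_inverse cone cinv cmul.
Proof. by move=> a; apply/ffunP => e; rewrite !ffunE mulgV. Qed.
Lemma cmulK c : cancel (cmul c) (cmul (cinv c)).
Proof. by move=> a; rewrite cmulA cmulVc cmul1c. Qed.
Lemma cmulKV c : cancel (cmul (cinv c)) (cmul c).
Proof. by move=> a; rewrite cmulA cmulcV cmul1c. Qed.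

Lemma upd_id a e : upd a e (a e) = a.
Proof. by apply/ffunP => e'; rewrite ffunE; case: eqP => [->|]. Qed.

Lemma upd_upd a e g k : upd (upd a e g) e k = upd a e k.
Proof. by apply/ffunP => e'; rewrite !ffunE; case: eqP. Qed.

Lemma upd_eq a e g : upd a e g e = g.
Proof. by rewrite ffunE eqxx. Qed.

Lemma cmul_single e g a : cmul (single e g) a = upd a e (g * a e)%g.
Proof. by apply/ffunP => e'; rewrite !ffunE; case: eqP => [->|]; rewrite ?mul1g. Qed.

Lemma agree_off1 e a b : agree_off [set e] a b = (a == upd b e (a e)).
Proof.
apply/forallP/eqP => [ab|-> e'].
  apply/ffunP => e'; rewrite ffunE; case: eqP => [->//|/eqP ne].
  by move: (ab e'); rewrite inE ne => /eqP.
by rewrite inE !ffunE; apply/implyP => /negPf ->; rewrite eqxx.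
Qed.

Lemma sum_agree_off1 e b (F : cfg -> C) :
  \sum_c (agree_off [set e] c b)%:R * F c = \sum_k F (upd b e k).
Proof.
rewrite [LHS](bigID (fun c => agree_off [set e] c b)) /= [X in _ + X]big1 ?addr0; last first.
  by move=> c /negPf ->; rewrite mul0r.
rewrite (reindex_onto (upd b e) (fun c => c e)) /=; last first.
  by move=> c; rewrite agree_off1 => /eqP <-.
apply: eq_big => k; first by rewrite agree_off1 !upd_eq !eqxx.
by move=> /andP[-> _]; rewrite mul1r.
Qed.

Lemma ent_mul_emb e O (X : siteOp) a b :
  ent (O *m emb e X) a b = \sum_k ent O a (upd b e k) * sent X k (b e).
Proof.
rewrite ent_mul.
transitivity (\sum_c (agree_off [set e] c b)%:R * (ent O a c * sent X (c e) (b e))).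
  by apply: eq_bigr => c _; rewrite ent_emb mulrCA.
rewrite (sum_agree_off1 e b (fun c => ent O a c * sent X (c e) (b e))).
by apply: eq_bigr => k _; rewrite upd_eq.
Qed.

Lemma ent_emb_mul e O (X : siteOp) a b :
  ent (emb e X *m O) a b = \sum_k sent X (a e) k * ent O (upd a e k) b.
Proof.
rewrite ent_mul.
transitivity (\sum_c (agree_off [set e] c a)%:R * (sent X (a e) (c e) * ent O c b)).
  by apply: eq_bigr => c _; rewrite ent_emb agree_offC mulrA.
rewrite (sum_agree_off1 e a (fun c => sent X (a e) (c e) * ent O c b)).
by apply: eq_bigr => k _; rewrite upd_eq.
Qed.

(** The existentially quantified kernel can be taken to be [ent O] itself, because configurations
    restricted to the complement of [V] agree on [V]. *)
Lemma supported_inC V O :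
  supported_in (~: V) O <->
  (forall a b, ent O a b = (agree_on V a b)%:R * ent O (restr (~: V) a) (restr (~: V) b)).
Proof.
have aV a b : agree_off (~: V) a b = agree_on V a b.
  by apply: eq_forallb => e; rewrite inE negbK.
have rr a : restr (~: V) (restr (~: V) a) = restr (~: V) a.
  by apply/ffunP => e; rewrite !ffunE; case: (e \in _).
have ar a b : agree_on V (restr (~: V) a) (restr (~: V) b).
  by apply/agree_onP => e eV; rewrite !ffunE inE eV.
split=> [[f ->] a b|Oab]; first by rewrite !ent_op_mx !aV ar mul1r !rr.
exists (fun a b => ent O a b); apply: entP => a b.
by rewrite ent_op_mx aV -Oab.
Qed.

(* An operator commuting with an irreducible set of one-site operators is, in each
   block with respect to the edge, a scalar matrix. *)
Lemma comm_irreducible_site (I : finType) (S : I -> siteOp) e O :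
  (forall X : siteOp, (forall i, X *m S i = S i *m X) -> exists c : C, X = c%:M) ->
  (forall i, O *m emb e (S i) = emb e (S i) *m O) ->
  forall a b, ent O a b = (a e == b e)%:R * ent O (upd a e 1%g) (upd b e 1%g).
Proof.
move=> irr cO a b.
pose X : siteOp := site_mx (fun g k => ent O (upd a e g) (upd b e k)).
have [i|c Xc] := irr X.
  apply/matrixP => x y; rewrite -[x]enum_valK -[y]enum_valK.
  set g := enum_val x; set k := enum_val y.
  rewrite -[LHS]/(sent _ g k) -[RHS]/(sent _ g k) !sent_mul.
  have := congr1 (fun Z => ent Z (upd a e g) (upd b e k)) (cO i).
  rewrite ent_mul_emb ent_emb_mul !upd_eq => E.
  under eq_bigr do rewrite sent_site_mx.
  under [RHS]eq_bigr do rewrite sent_site_mx.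
  under eq_bigr do rewrite -(upd_upd b e k).
  by under [RHS]eq_bigr do rewrite -(upd_upd a e g).
have Xent g k : ent O (upd a e g) (upd b e k) = c *+ (g == k).
  transitivity (sent X g k); first by rewrite sent_site_mx.
  by rewrite Xc /sent mxE (inj_eq enum_rank_inj).
by rewrite -{1}(upd_id a e) -{1}(upd_id b e) !Xent eqxx mulr1n mulr_natl.
Qed.

(** The scalar form at one edge is applied to the edges of [V] in turn, until entries depend only on
    the restrictions to the complement. *)
Lemma supported_of_comm (I : finType) (S : edge N -> I -> siteOp) V O :
  (forall e (X : siteOp), (forall i, X *m S e i = S e i *m X) -> exists c : C, X = c%:M) ->
  (forall e i, e \in V -> O *m emb e (S e i) = emb e (S e i) *m O) ->
  supported_in (~: V) O.
Proof.
move=> irr cO; apply/supported_inC => a b.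
have site e a' b' : e \in V ->
    ent O a' b' = (a' e == b' e)%:R * ent O (upd a' e 1%g) (upd b' e 1%g).
  by move=> eV; apply: (comm_irreducible_site (irr e)) => i; exact: cO.
have [ab|] := boolP (agree_on V a b); last first.
  case/forall_inPn => e eV ne.
  by rewrite (site e) // (negPf ne) !mul0r.
rewrite mul1r.
(* [clr s] resets a configuration to the identity on the edges already processed. *)
pose clr (s : seq (edge N)) a : cfg := [ffun e => if e \in s then 1%g else a e].
have clr_ent s : {subset s <= V} -> ent O a b = ent O (clr s a) (clr s b).
  elim: s => [_|e s IH sV].
    by congr ent; apply/ffunP => e; rewrite ffunE.
  rewrite IH; last by move=> e' e's; apply: sV; rewrite inE e's orbT.
  have eV : e \in V by apply: sV; rewrite inE eqxx.
  have updE x : upd (clr s x) e 1%g = clr (e :: s) x.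
    by apply/ffunP => e'; rewrite !ffunE inE; case: eqP.
  rewrite (site e) // !updE !ffunE.
  by case: ifP => _; rewrite ?eqxx ?mul1r // (agree_onP _ _ _ ab _ eV) eqxx mul1r.
rewrite (clr_ent (enum V)); last by move=> e; rewrite mem_enum.
by congr ent; apply/ffunP => e; rewrite !ffunE mem_enum inE; case: (e \in V).
Qed.

Section Supported.
Variables (V : {set edge N}) (O : Op).
Hypothesis sO : supported_in (~: V) O.

Lemma supported_ent0 e a b : e \in V -> a e != b e -> ent O a b = 0.
Proof.
move=> eV ne; move/supported_inC: sO => ->.
suff /negPf -> : ~~ agree_on V a b by rewrite mul0r.
by rewrite /agree_on; apply/forall_inPn; exists e.
Qed.

Lemma supported_translate a b c : trivial_off V c ->
  ent O (cmul c a) (cmul c b) = ent O a b.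
Proof.
move=> cV; move/supported_inC: sO => Oab; rewrite Oab [RHS]Oab.
have rE x : restr (~: V) (cmul c x) = restr (~: V) x.
  apply/ffunP => e; rewrite !ffunE inE; case: ifP => // eV.
  by rewrite cV // mul1g.
rewrite !rE; congr ((_ : bool)%:R * _).
by apply: eq_forallb => e; rewrite !ffunE (inj_eq (mulgI _)).
Qed.

Lemma supported_comm e (X : siteOp) : e \in V -> O *m emb e X = emb e X *m O.
Proof.
move=> eV; apply: entP => a b; rewrite ent_mul_emb ent_emb_mul.
rewrite (bigD1 (a e)) //= big1 => [|k nk]; last first.
  by rewrite (supported_ent0 eV) ?mul0r // upd_eq eq_sym.
rewrite [RHS](bigD1 (b e)) //= [X in _ = _ + X]big1 => [|k nk]; last first.
  by rewrite (supported_ent0 eV) ?mulr0 // upd_eq.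
rewrite !addr0 mulrC; congr (_ * _).
(* One term survives on each side. This translation carries the value [a e] at [e] to [b e] and so
   matches the two entries of [O]. *)
rewrite -(@supported_translate _ _ (single e (b e * (a e)^-1)%g)).
  by rewrite !cmul_single upd_eq upd_upd mulgKV upd_id.
by move=> e' ne'; rewrite ffunE; case: eqP ne' => // ->; rewrite eV.
Qed.

End Supported.
End Support.

(** * Shift operators and diagonal operators *)

Section ShiftDiag.
Variables (R : realType) (gT : finGroupType) (N : nat).
Local Notation C := (R[i]).
Local Notation cfg := (cfg gT N).
Local Notation Op := (Op R gT N).
Local Notation siteOp := (siteOp R gT).
Implicit Types (a b c : cfg) (X Y O : Op) (e : edge N) (V : {set edge N}).

Definition shift_op c : Op := op_mx (fun a b => (a == cmul c b)%:R).
Definition diag_op (f : cfg -> C) : Op := op_mx (fun a b => (a == b)%:R * f a).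

Lemma ent_mul_shift X c a b : ent (X *m shift_op c) a b = ent X a (cmul c b).
Proof.
rewrite ent_mul (bigD1 (cmul c b)) //= big1 ?addr0 => [|d nd].
  by rewrite ent_op_mx eqxx mulr1.
by rewrite ent_op_mx (negPf nd) mulr0.
Qed.

Lemma ent_shift_mul X c a b : ent (shift_op c *m X) (cmul c a) b = ent X a b.
Proof.
rewrite ent_mul (bigD1 a) //= big1 ?addr0 => [|d nd].
  by rewrite ent_op_mx eqxx mul1r.
by rewrite ent_op_mx (inj_eq (can_inj (cmulK c))) eq_sym (negPf nd) mul0r.
Qed.

Lemma ent_mul_diag X f a b : ent (X *m diag_op f) a b = ent X a b * f b.
Proof.
rewrite ent_mul (bigD1 b) //= big1 ?addr0 => [|d nd].
  by rewrite ent_op_mx eqxx mul1r.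
by rewrite ent_op_mx (negPf nd) mul0r mulr0.
Qed.

Lemma ent_diag_mul X f a b : ent (diag_op f *m X) a b = f a * ent X a b.
Proof.
rewrite ent_mul (bigD1 a) //= big1 ?addr0 => [|d nd].
  by rewrite ent_op_mx eqxx mul1r.
by rewrite ent_op_mx eq_sym (negPf nd) !mul0r.
Qed.

Lemma shift_opM c d : shift_op c *m shift_op d = shift_op (cmul c d).
Proof.
by apply: entP => a b; rewrite ent_mul_shift !ent_op_mx cmulA.
Qed.

Lemma shift_op1 : shift_op (cone gT N) = 1%:M.
Proof.
apply: entP => a b; rewrite ent_op_mx cmul1c /ent mxE.
by rewrite (inj_eq enum_rank_inj).
Qed.

Lemma diag_opM f g : diag_op f *m diag_op g = diag_op (fun a => f a * g a).
Proof.
apply: entP => a b; rewrite ent_mul_diag !ent_op_mx.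
by case: eqP => [->|]; rewrite ?mul1r ?mul0r.
Qed.

Lemma diag_op1 : diag_op (fun=> 1) = 1%:M.
Proof.
apply: entP => a b; rewrite ent_op_mx mulr1 /ent mxE.
by rewrite (inj_eq enum_rank_inj).
Qed.

Lemma diag_op_ext f g : f =1 g -> diag_op f = diag_op g.
Proof. by move=> fg; apply: entP => a b; rewrite !ent_op_mx fg. Qed.

Lemma adj_shift c : adj (shift_op c) = shift_op (cinv c).
Proof.
apply: entP => a b; rewrite ent_adj !ent_op_mx conjc_nat.
by congr ((_ : bool)%:R); apply/eqP/eqP => [->|->]; rewrite ?cmulK ?cmulKV.
Qed.

Lemma adj_diag f : adj (diag_op f) = diag_op (fun a => conjc (f a)).
Proof.
apply: entP => a b; rewrite ent_adj !ent_op_mx eq_sym.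
case: eqP => [->|_]; rewrite ?mul1r ?mul0r //; exact: conjc0.
Qed.

Lemma shift_diag_comm c f : (forall a, f (cmul c a) = f a) ->
  shift_op c *m diag_op f = diag_op f *m shift_op c.
Proof.
move=> fc; apply: entP => a b; rewrite ent_mul_diag ent_diag_mul !ent_op_mx.
by case: eqP => [->|]; rewrite ?mul0r ?mulr0 // fc mulrC.
Qed.

Lemma emb_opL e g : emb e (opL R g) = shift_op (single e g).
Proof.
apply: entP => a b; rewrite ent_emb sent_site_mx ent_op_mx cmul_single agree_off1.
rewrite -natrM mulnb; congr ((_ : bool)%:R); apply/andP/eqP => [[/eqP e1 /eqP e2]|->].
  by rewrite {1}e1 e2.
by rewrite upd_eq !eqxx.
Qed.

Lemma emb_opM e (chi : gT -> C) : emb e (opM chi) = diag_op (fun a => chi (a e)).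
Proof.
apply: entP => a b; rewrite ent_emb sent_site_mx ent_op_mx agree_off1 mulrA -natrM mulnb.
congr ((_ : bool)%:R * _); apply/andP/eqP => [[/eqP e1 /eqP e2]|->].
  by rewrite e1 e2 upd_id.
by rewrite upd_id !eqxx.
Qed.

Lemma prod_emb_opL (A : {set edge N}) g :
  \prod_(e in A) emb e (opL R g) = shift_op [ffun e => if e \in A then g else 1%g].
Proof.
rewrite -big_filter; set r := seq.filter _ _.
(* Absence of repetitions matters: an edge listed twice would be shifted by [g] twice. *)
have ur : uniq r by rewrite filter_uniq ?index_enum_uniq.
have -> : [ffun e => if e \in A then g else 1%g] = [ffun e => if e \in r then g else 1%g].
  by apply/ffunP => e; rewrite !ffunE mem_filter mem_index_enum andbT.
elim: r ur => [_|e s IH /= /andP[es us]].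
  rewrite big_nil -[1]/(1%:M : Op) -shift_op1; exact: congr1.
rewrite big_cons IH // emb_opL -mulmxE shift_opM; congr shift_op.
apply/ffunP => e'; rewrite !ffunE inE; case: eqP => [->|_] /=; last by rewrite mul1g.
by rewrite (negPf es) mulg1.
Qed.

Lemma prod_emb_opM (A : {set edge N}) (chi : gT -> C) :
  \prod_(e in A) emb e (opM chi) = diag_op (fun a => \prod_(e in A) chi (a e)).
Proof.
rewrite -big_filter; set r := seq.filter _ _.
rewrite (diag_op_ext (g := fun a => \prod_(e <- r) chi (a e))); last first.
  by move=> a; rewrite big_filter.
elim: r => [|e s IH].
  rewrite big_nil -[1]/(1%:M : Op) -diag_op1.
  by apply: diag_op_ext => a; rewrite big_nil.
rewrite big_cons IH emb_opM -mulmxE diag_opM.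
by apply: diag_op_ext => a; rewrite big_cons.
Qed.

End ShiftDiag.

(** * Characters of the group *)

Section Characters.
Variables (R : realType) (gT : finGroupType).
Local Notation C := (R[i]).
Local Notation chars := (@Defs.chars R gT).
Implicit Types (chi : {ffun gT -> C}) (g k : gT).

Lemma charM chi g k : chars chi -> chi (g * k)%g = chi g * chi k.
Proof. by case. Qed.

Lemma char_conj chi g : chars chi -> chi g * conjc (chi g) = 1.
Proof. by case=> _ chi1; rewrite -[conjc _]/((chi g)^*) -normCK chi1 expr1n. Qed.

Lemma char1 chi : chars chi -> chi 1%g = 1.
Proof.
move=> hchi; have := char_conj 1%g hchi.
by rewrite -{1}(mulg1 1%g) charM // -mulrA (char_conj _ hchi) mulr1.
Qed.

Lemma charV chi g : chars chi -> chi (g^-1)%g = conjc (chi g).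
Proof.
move=> hchi; rewrite -[LHS]mulr1 -(char_conj g hchi) mulrA -charM // mulVg.
by rewrite char1 // mul1r.
Qed.

Definition conj_char chi : {ffun gT -> C} := [ffun g => conjc (chi g)].

Lemma conj_charK : involutive conj_char.
Proof. by move=> chi; apply/ffunP => g; rewrite !ffunE conjcK. Qed.

Lemma conj_charP chi : chars chi -> chars (conj_char chi).
Proof.
move=> hchi; split=> [g k|g]; rewrite !ffunE.
  by rewrite charM //; exact: rmorphM.
by rewrite -[conjc _]/((chi g)^*) norm_conjC; case: hchi.
Qed.

Lemma charX chi g n : chars chi -> chi (g ^+ n)%g = chi g ^+ n.
Proof.
move=> hchi; elim: n => [|n IH]; first by rewrite expg0 expr0 char1.
by rewrite expgS charM // IH exprS.
Qed.

(* The values of a character are [#|G|]-th roots of unity. *)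
Lemma finite_chars : finite_set (chars).
Proof.
pose n := #|[set: gT]%G|; have n_gt0 : (0 < n)%N by exact: cardG_gt0.
have [r Er] := closed_field_poly_normal ('X^n - 1 : {poly C}).
(* A character is encoded by the positions of its values in the list of roots; [index] is only
   bounded by [size r] inclusively, hence the successor. *)
pose f (k : {ffun gT -> 'I_(size r).+1}) : {ffun gT -> C} := [ffun g => r`_(k g)].
apply: (sub_finite_set _ (finite_seq [seq f x | x <- enum {: {ffun gT -> 'I_(size r).+1}}])).
move=> chi hchi /=; apply/mapP.
exists [ffun g => inord (index (chi g) r)]; first by rewrite mem_enum.
apply/ffunP => g; rewrite !ffunE inordK; last by rewrite ltnS index_size.
rewrite nth_index //; suff : root ('X^n - 1) (chi g).
  rewrite Er (monicP _) ?scale1r ?root_prod_XsubC //.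
  exact: monicXnsubC.
rewrite rootE !hornerE -charX //.
have /dvdnP[q ->] : (#[g]%g %| n)%N by apply: cardSg; rewrite finset.subsetT.
by rewrite mulnC expgM expg_order expg1n char1 // subrr.
Qed.

Lemma mem_chars chi : chi \in finmap.enum_fset (fset_set (chars)) <-> chars chi.
Proof.
by rewrite -[_ \in _]/(chi \in fset_set _) in_fset_set ?inE; [|exact: finite_chars];
   split=> [/set_mem|/mem_set].
Qed.

Lemma sum_conj_chars (V : nmodType) (F : {ffun gT -> C} -> V) :
  \sum_(chi <- fset_set (chars)) F (conj_char chi)
  = \sum_(chi <- fset_set (chars)) F chi.
Proof.
rewrite -(big_map conj_char predT F); apply: perm_big; apply: uniq_perm.
- by rewrite (map_inj_uniq (can_inj conj_charK)) fset_uniq.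
- exact: fset_uniq.
move=> chi; apply/mapP/idP => [[chi' /mem_chars h ->]|/mem_chars h].
  exact/mem_chars/conj_charP.
by exists (conj_char chi); rewrite ?conj_charK //; apply/mem_chars/conj_charP.
Qed.

End Characters.

(** * Incidence geometry of the torus *)

Section Geometry.
Variable N : nat.
Implicit Types (e : edge N) (s : vertex N) (p : plaq N) (V : {set edge N}).

(** Every edge lies in exactly one [dplus], [dminus], [bplus] and [bminus]. The maps [src], [tgt],
    [ccw] and [cw] name these cells, so that incidence becomes an equation. *)
Definition src e : vertex N := if e.2 then (ordS e.1.1, e.1.2) else (e.1.1, ordS e.1.2).
Definition tgt e : vertex N := e.1.
Definition ccw e : plaq N := if e.2 then (e.1.1, ord_pred e.1.2) else e.1.
Definition cw e : plaq N := if e.2 then e.1 else (ord_pred e.1.1, e.1.2).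

Lemma eq_ord_pred n (x y : 'I_n) : (x == ord_pred y) = (ordS x == y).
Proof. by apply/eqP/eqP => [->|<-]; rewrite ?ord_predK ?ordSK. Qed.

Lemma mem_dplus e s : (e \in dplus s) = (src e == s).
Proof.
by case: e s => -[x y] [] [s1 s2];
  rewrite !inE /src !xpair_eqE /= ?andbT ?andbF ?orbF // eq_ord_pred.
Qed.

Lemma mem_dminus e s : (e \in dminus s) = (tgt e == s).
Proof.
by case: e s => -[x y] [] [s1 s2]; rewrite !inE /tgt !xpair_eqE /= ?andbT ?andbF ?orbF.
Qed.

Lemma mem_bplus e p : (e \in bplus p) = (ccw e == p).
Proof.
case: e p => -[x y] [] [s1 s2]; rewrite !inE /ccw !xpair_eqE /= ?andbT ?andbF ?orbF //.
by congr (_ && _); rewrite [RHS]eq_sym eq_ord_pred eq_sym.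
Qed.

Lemma mem_bminus e p : (e \in bminus p) = (cw e == p).
Proof.
case: e p => -[x y] [] [s1 s2]; rewrite !inE /cw !xpair_eqE /= ?andbT ?andbF ?orbF //.
by congr (_ && _); rewrite [RHS]eq_sym eq_ord_pred eq_sym.
Qed.

Lemma mem_dstar e s : (e \in dstar s) = (src e == s) || (tgt e == s).
Proof. by rewrite inE mem_dplus mem_dminus. Qed.

Lemma mem_bplaq e p : (e \in bplaq p) = (ccw e == p) || (cw e == p).
Proof. by rewrite inE mem_bplus mem_bminus. Qed.

(** A star fixes the row of its horizontal and the column of its vertical edges. A plaquette fixes
    the other coordinate, so a common star and a common plaquette together determine an edge of
    known direction. *)
Lemma dstar_coord e s : e \in dstar s -> if e.2 then e.1.2 = s.2 else e.1.1 = s.1.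
Proof. by rewrite mem_dstar /src /tgt; case: e => -[x y] [] /= /orP[] /eqP <-. Qed.

Lemma bplaq_coord e p : e \in bplaq p -> if e.2 then e.1.1 = p.1 else e.1.2 = p.2.
Proof. by rewrite mem_bplaq /ccw /cw; case: e => -[x y] [] /= /orP[] /eqP <-. Qed.

Lemma ordS_neq (x : 'I_N) : (2 <= N)%N -> ordS x != x.
Proof.
move=> N2; apply/eqP => /(congr1 val) /= e.
have := ltn_ord x; rewrite leq_eqVlt => /orP[/eqP xN|xN].
  by move: e; rewrite xN modnn => e; move: N2; rewrite -xN -e.
by move: e; rewrite modn_small // => /eqP; rewrite eqn_leq ltnn.
Qed.

Lemma src_neq_tgt e : (2 <= N)%N -> src e != tgt e.
Proof.
move=> N2; case: e => -[x y] []; rewrite /src /tgt !xpair_eqE /= eqxx ?andbT;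
  exact: ordS_neq.
Qed.

Lemma ccw_neq_cw e : (2 <= N)%N -> ccw e != cw e.
Proof.
move=> N2; case: e => -[x y] []; rewrite /ccw /cw !xpair_eqE /= eqxx ?andbT eq_sym ?eq_ord_pred;
  by rewrite ?(eq_sym _ (ord_pred _)) ?(eq_sym (ord_pred _)) ?eq_ord_pred ordS_neq.
Qed.

Section Confinement.
Variables (T : finType) (cell : T -> {set edge N}) (f g : edge N -> T) (r : rel (edge N)).
Hypothesis mem_cell : forall e v, (e \in cell v) = (f e == v) || (g e == v).
Hypothesis rP : forall e e', r e e' -> exists v, (e \in cell v) && (e' \in cell v).

(* An edge lies in two cells only, so a connected region cannot be left through
   an edge lying in both of [v] and [v']. *)
Lemma connected_confined V v v' e0 : connected_by r V -> v != v' ->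
  e0 \in V -> e0 \in cell v ->
  (forall e, e \in V -> (e \in cell v) = (e \in cell v')) ->
  forall e, e \in V -> e \in cell v.
Proof.
move=> cV vv' e0V e0v same e eV.
have [q [pq <- qV]] := cV _ _ e0V eV.
elim: q e0 e0V e0v pq qV => //= e1 q IH e0 e0V e0v /andP[r01 pq] /andP[e1V qV].
apply: IH => //; have [t /andP[e0t e1t]] := rP r01.
have e0v' : e0 \in cell v' by rewrite -same.
suff /orP[/eqP <-//|/eqP tv'] : (t == v) || (t == v') by rewrite same // -tv'.
move: e0v e0v' e0t; rewrite !mem_cell.
by move=> /orP[] /eqP Ev /orP[] /eqP Ev' /orP[] /eqP Et;
  first [by move: vv'; rewrite -Ev -Ev' eqxx | by rewrite -Et ?Ev ?Ev' eqxx ?orbT].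
Qed.

End Confinement.

(** Propagation along a path; applied with the adjacency opposite to the one used for confinement,
    it collapses the region to one edge. *)
Lemma connected_locally_constant (r : rel (edge N)) V : connected_by r V ->
  (forall e e', e \in V -> e' \in V -> r e e' -> e = e') ->
  forall e e', e \in V -> e' \in V -> e = e'.
Proof.
move=> cV loc e e' eV e'V; have [q [pq <- qV]] := cV _ _ eV e'V.
elim: q e eV pq qV => //= e1 q IH e0 e0V /andP[r01 pq] /andP[e1V qV].
by rewrite (loc _ _ e0V e1V r01); apply: IH.
Qed.

Section TwoConnected.
Variable V : {set edge N}.
Hypotheses (Vs : star_connected V) (Vp : plaquette_connected V) (V2 : (2 <= #|V|)%N).

Lemma not_all_equal : ~ (forall e e', e \in V -> e' \in V -> e = e').
Proof.
move=> all_eq; have /card_gt1P[e [e' [eV e'V]]] : (1 < #|V|)%N by [].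
by rewrite (all_eq _ _ eV e'V) eqxx.
Qed.

(** If distinct [s] and [s'] had the same trace, star-connectedness would confine [V] to their
    common edges. These share one direction, so two of them in a common plaquette coincide, and
    plaquette-connectedness leaves a single edge. The argument includes [N = 2], where neighbouring
    stars share two edges. *)
Lemma star_trace_inj s s' e0 : e0 \in V -> e0 \in dstar s ->
  (forall e, e \in V -> (e \in dstar s) = (e \in dstar s')) -> s = s'.
Proof.
move=> e0V e0s same; apply/eqP/negP => /negP ss'; apply: not_all_equal.
have adjP e e' : star_adj e e' -> exists v, (e \in dstar v) && (e' \in dstar v).
  by move/existsP.
have conf := connected_confined mem_dstar adjP Vs ss' e0V e0s same.
apply: (connected_locally_constant Vp) => e e' eV e'V /existsP[p /andP[ep e'p]].
have es := conf e eV; have e's := conf e' e'V.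
have es' := es; have e's' := e's; rewrite !same // in es' e's'.
(* An edge common to two distinct stars is horizontal exactly when their columns differ. *)
have typ x : x \in dstar s -> x \in dstar s' -> x.2 = (s.1 != s'.1).
  move=> /dstar_coord + /dstar_coord; case: x => -[x y] [] /= -> E; last by rewrite E eqxx.
  by apply/esym; apply: contraNN ss' => /eqP E1; apply/eqP/injective_projections.
have := (dstar_coord es, dstar_coord e's, bplaq_coord ep, bplaq_coord e'p).
move: (typ e es es') (typ e' e's e's').
case: (e) => -[x y] b; case: (e') => -[x' y'] b' /= -> ->.
by case: ifP => _ [[[-> ->] ->] ->].
Qed.

(** The dual argument, with stars and plaquettes exchanging roles. *)
Lemma plaq_trace_inj p p' e0 : e0 \in V -> e0 \in bplaq p ->
  (forall e, e \in V -> (e \in bplaq p) = (e \in bplaq p')) -> p = p'.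
Proof.
move=> e0V e0s same; apply/eqP/negP => /negP ss'; apply: not_all_equal.
have adjP e e' : plaq_adj e e' -> exists v, (e \in bplaq v) && (e' \in bplaq v).
  by move/existsP.
have conf := connected_confined mem_bplaq adjP Vp ss' e0V e0s same.
apply: (connected_locally_constant Vs) => e e' eV e'V /existsP[s /andP[ep e'p]].
have es := conf e eV; have e's := conf e' e'V.
have es' := es; have e's' := e's; rewrite !same // in es' e's'.
have typ x : x \in bplaq p -> x \in bplaq p' -> x.2 = (p.2 != p'.2).
  move=> /bplaq_coord + /bplaq_coord; case: x => -[x y] [] /= -> E; last by rewrite E eqxx.
  by apply/esym; apply: contraNN ss' => /eqP E1; apply/eqP/injective_projections.
have := (bplaq_coord es, bplaq_coord e's, dstar_coord ep, dstar_coord e'p).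
move: (typ e es es') (typ e' e's e's').
case: (e) => -[x y] b; case: (e') => -[x' y'] b' /= -> ->.
by case: ifP => _ [[[-> ->] ->] ->].
Qed.

End TwoConnected.
End Geometry.

(** * Star and plaquette operators *)

Section StarPlaquette.
Variables (R : realType) (gT : finGroupType) (N : nat).
Local Notation C := (R[i]).
Local Notation cfg := (cfg gT N).
Local Notation Op := (Op R gT N).
Local Notation siteOp := (siteOp R gT).
Local Notation chars := (@Defs.chars R gT).
Local Notation charseq := (finmap.enum_fset (fset_set chars)).
Implicit Types (a b c : cfg) (X Y O : Op) (e : edge N) (V : {set edge N}).
Implicit Types (s : vertex N) (p : plaq N) (g : gT) (chi : {ffun gT -> C}).

(** The gauge transformation by [g] at [s], written as a configuration: [A_s(g)] is the shift by
    it. *)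
Definition star_cfg s g : cfg :=
  [ffun e => ((if src e == s then g else 1) * (if tgt e == s then g^-1 else 1))%g].

(** The [chi]-holonomy around [p], that is, the eigenvalue of [B_p(chi)] on the basis vector [a]. *)
Definition hol p chi a : C :=
  (\prod_(e in bplus p) chi (a e)) * \prod_(e in bminus p) conjc (chi (a e)).

Lemma Astar_gE s g : Astar_g R s g = shift_op R (star_cfg s g).
Proof.
rewrite /Astar_g !prod_emb_opL -mulmxE shift_opM; congr shift_op.
by apply/ffunP => e; rewrite !ffunE mem_dplus mem_dminus.
Qed.

Lemma AstarE s : Astar R gT s = (#|{: gT}|%:R)^-1 *: \sum_g shift_op R (star_cfg s g).
Proof. by rewrite /Astar; under eq_bigr do rewrite Astar_gE. Qed.

Lemma Bplaq_chiE p chi : Bplaq_chi p chi = diag_op (hol p chi).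
Proof.
by rewrite /Bplaq_chi prod_emb_opM (prod_emb_opM _ (fun g => conjc (chi g))) -mulmxE diag_opM.
Qed.

Lemma BplaqE p : Bplaq R gT p =
  diag_op (fun a => (#|{: gT}|%:R)^-1 * \sum_(chi <- charseq) hol p chi a).
Proof.
rewrite /Bplaq fsbig_finite; last exact: finite_chars.
apply: entP => a b; rewrite entZ ent_sum ent_op_mx mulrCA; congr (_ * _).
rewrite mulr_sumr; apply: eq_bigr => chi _.
by rewrite Bplaq_chiE ent_op_mx.
Qed.

Lemma holM p chi a b : chars chi -> hol p chi (cmul a b) = hol p chi a * hol p chi b.
Proof.
move=> hchi; rewrite /hol mulrACA -!big_split /=; congr (_ * _); apply: eq_bigr => e _.
  by rewrite ffunE charM.
by rewrite ffunE charM //; exact: rmorphM.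
Qed.

Lemma hol_conj p chi a : hol p (conj_char chi) a = conjc (hol p chi a).
Proof.
transitivity (conjc (\prod_(e in bplus p) chi (a e)) *
              conjc (\prod_(e in bminus p) conjc (chi (a e)))); last first.
  by apply/esym; exact: rmorphM.
congr (_ * _); rewrite (big_morph _ (@rmorphM _ _ (@conjc R)) (@conjc1 R));
  by apply: eq_bigr => e _; rewrite ffunE.
Qed.

Lemma hol_norm p chi a : chars chi -> hol p chi a * conjc (hol p chi a) = 1.
Proof.
move=> hchi; rewrite -hol_conj /hol mulrACA -!big_split /= !big1 ?mulr1 // => e _.
  by have := char_conj (a e) (conj_charP hchi); rewrite !ffunE.
by rewrite ffunE char_conj.
Qed.

Lemma prod_single (A : {set edge N}) (f : gT -> C) e g : f 1%g = 1 ->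
  \prod_(e' in A) f (single e g e') = if e \in A then f g else 1.
Proof.
move=> f1; case: ifPn => eA.
  rewrite (bigD1 e) //= big1 ?mulr1 ?ffunE ?eqxx // => e' /andP[_ /negPf ne].
  by rewrite ffunE ne.
rewrite big1 // => e' e'A; rewrite ffunE; case: eqP e'A => // ->.
by rewrite (negPf eA).
Qed.

Lemma hol_single p chi e g : chars chi ->
  hol p chi (single e g) =
  (if ccw e == p then chi g else 1) * (if cw e == p then conjc (chi g) else 1).
Proof.
move=> hchi; rewrite /hol (prod_single _ _ _ (char1 hchi)).
rewrite (prod_single _ (f := fun g => conjc (chi g))) ?mem_bplus ?mem_bminus //.
by rewrite char1 // conjc1.
Qed.

Lemma hol_upd p chi a e g : e \notin bplaq p -> hol p chi (upd a e g) = hol p chi a.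
Proof.
rewrite inE negb_or => /andP[ep em]; congr (_ * _); apply: eq_bigr => e' e'p;
  rewrite ffunE; case: eqP e'p => // ->; first by rewrite (negPf ep).
by rewrite (negPf em).
Qed.

Lemma holE p chi a : hol p chi a =
  chi (a (hE p.1 (ordS p.2))) * chi (a (vE p.1 p.2)) *
  (conjc (chi (a (hE p.1 p.2))) * conjc (chi (a (vE (ordS p.1) p.2)))).
Proof. by rewrite /hol !big_setU1 ?big_set1 //= inE xpair_eqE andbF. Qed.

(* Around a plaquette the gauge transformation telescopes. *)
Lemma hol_gauge p chi s g a : chars chi ->
  hol p chi (cmul (star_cfg s g) a) = hol p chi a.
Proof.
move=> hchi; rewrite holM //.
(* Seen through [chi], the gauge transformation is the coboundary of the vertex function [phi]: its
   value on an edge is [phi] at the source times conjugate [phi] at the target. *)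
pose phi v := if v == s then chi g else 1.
have phiN v : phi v * conjc (phi v) = 1.
  by rewrite /phi; case: ifP => _; rewrite ?char_conj // conjc1 mulr1.
have chiE e : chi (star_cfg s g e) = phi (src e) * conjc (phi (tgt e)).
  rewrite ffunE charM // /phi; congr (_ * _); first by case: ifP => _; rewrite ?char1.
  by case: ifP => _; [exact: charV | rewrite char1 //; exact/esym/conjc1].
have chiE' e : conjc (chi (star_cfg s g e)) = conjc (phi (src e)) * phi (tgt e).
  rewrite chiE -[X in _ = _ * X](conjcK (phi (tgt e))); exact: rmorphM.
rewrite holE !chiE' !chiE /src /tgt /=.
case: p => x y /=.
have telescope (K : comPzRingType) (u11 v11 u01 v01 u10 v10 u00 v00 : K) :
    u11 * v11 = 1 -> u01 * v01 = 1 -> u10 * v10 = 1 -> u00 * v00 = 1 ->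
    u11 * v01 * (u01 * v00) * (v10 * u00 * (v11 * u10)) = 1.
  move=> e1 e2 e3 e4.
  transitivity ((u11 * v11) * (u01 * v01) * ((u10 * v10) * (u00 * v00))); first by ring.
  by rewrite e1 e2 e3 e4 !mulr1.
by rewrite telescope ?mul1r.
Qed.

Lemma emb_shift_comm e (X : siteOp) c : c e = 1%g ->
  shift_op R c *m emb e X = emb e X *m shift_op R c.
Proof.
move=> ce; apply: entP => a b; rewrite -[a](cmulKV c) ent_shift_mul ent_mul_shift !ent_emb.
set a' := cmul (cinv c) a; rewrite !ffunE ce !mul1g; congr ((_ : bool)%:R * _).
by apply: eq_forallb => e'; rewrite !ffunE (inj_eq (mulgI _)).
Qed.

Lemma emb_diag_comm e (X : siteOp) (f : cfg -> C) : (forall a g, f (upd a e g) = f a) ->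
  diag_op f *m emb e X = emb e X *m diag_op f.
Proof.
move=> fe; apply: entP => a b; rewrite ent_diag_mul ent_mul_diag mulrC ent_emb agree_off1.
by case: eqP => [->|_]; rewrite ?mul0r // fe.
Qed.

Lemma Astar_emb_comm V s e (X : siteOp) : s \notin stars_of V -> e \in V ->
  Astar R gT s *m emb e X = emb e X *m Astar R gT s.
Proof.
rewrite inE negbK => sV eV; rewrite AstarE -scalemxAl -scalemxAr; congr (_ *: _).
rewrite mulmx_suml mulmx_sumr; apply: eq_bigr => g _; apply: emb_shift_comm.
have : e \notin dstar s by apply: contraL eV => es; rewrite (disjointFr sV es).
by rewrite mem_dstar negb_or ffunE => /andP[/negPf -> /negPf ->]; rewrite mulg1.
Qed.

Lemma Bplaq_emb_comm V p e (X : siteOp) : p \notin plaqs_of V -> e \in V ->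
  Bplaq R gT p *m emb e X = emb e X *m Bplaq R gT p.
Proof.
rewrite inE negbK => sV eV; rewrite BplaqE; apply: emb_diag_comm => a g.
congr (_ * _); apply: eq_bigr => chi _; apply: hol_upd.
by apply: contraL eV => es; rewrite (disjointFr sV es).
Qed.

Lemma Bplaq_comm p p' : Bplaq R gT p *m Bplaq R gT p' = Bplaq R gT p' *m Bplaq R gT p.
Proof. by rewrite !BplaqE !diag_opM; apply: diag_op_ext => a; rewrite mulrC. Qed.

Lemma Astar_Bplaq_comm s p : Astar R gT s *m Bplaq R gT p = Bplaq R gT p *m Astar R gT s.
Proof.
rewrite AstarE BplaqE -scalemxAl -scalemxAr; congr (_ *: _).
rewrite mulmx_suml mulmx_sumr; apply: eq_bigr => g _; apply: shift_diag_comm => a.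
congr (_ * _); rewrite !big_seq; apply: eq_bigr => chi /mem_chars hchi.
exact: hol_gauge.
Qed.

Lemma Bplaq_adj p : adj (Bplaq R gT p) = Bplaq R gT p.
Proof.
rewrite BplaqE adj_diag; apply: diag_op_ext => a.
transitivity (conjc ((#|{: gT}|%:R)^-1 : C) * conjc (\sum_(chi <- charseq) hol p chi a)).
  exact: rmorphM.
rewrite conjc_inv conjc_nat; congr (_ * _).
rewrite -[RHS](sum_conj_chars (fun chi => hol p chi a)).
rewrite (big_morph _ (@rmorphD _ _ (@conjc R)) (@conjc0 R)).
by apply: eq_bigr => chi _; rewrite hol_conj.
Qed.

Section Abelian.
Hypothesis abG : abelian [set: gT].

Lemma mulgC_abelian (g k : gT) : (g * k = k * g)%g.
Proof. by apply: (centsP abG); rewrite inE. Qed.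

Lemma cmulC a b : cmul a b = cmul b a.
Proof. by apply/ffunP => e; rewrite !ffunE mulgC_abelian. Qed.

Lemma Astar_comm s s' : Astar R gT s *m Astar R gT s' = Astar R gT s' *m Astar R gT s.
Proof.
rewrite !AstarE -!scalemxAl -!scalemxAr; congr (_ *: (_ *: _)).
rewrite mulmx_suml mulmx_sumr; apply: eq_bigr => g _.
rewrite mulmx_suml mulmx_sumr; apply: eq_bigr => k _.
by rewrite !shift_opM cmulC.
Qed.

Lemma Astar_adj s : adj (Astar R gT s) = Astar R gT s.
Proof.
rewrite adj_ctr AstarE ctrZ fmorphV rmorph_nat ctr_sum; congr (_ *: _).
rewrite [RHS](reindex_inj invg_inj); apply: eq_bigr => g _ /=.
rewrite -adj_ctr adj_shift; congr shift_op; apply/ffunP => e; rewrite !ffunE invMg mulgC_abelian.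
by do 2!case: ifP => _; rewrite ?invgK ?invg1.
Qed.

Lemma Ham_adj V : adj (Ham R gT V) = Ham R gT V.
Proof.
rewrite adj_ctr /Ham ctrD !ctrN !ctr_sum; congr (- _ - _); apply: eq_bigr => t _.
  by rewrite -adj_ctr Astar_adj.
by rewrite -adj_ctr Bplaq_adj.
Qed.

End Abelian.
End StarPlaquette.

(** * Vandermonde separation and commutator identities *)

(** Vanishing of all power moments gives vanishing against every polynomial, in particular against
    one whose roots are all nodes but [w0]. *)
Lemma vandermonde_eq0 (K : fieldType) (W : lmodType K) (T : eqType) (f : T -> K)
    (ws : seq T) (v : T -> W) :
  injective f -> uniq ws -> (forall k, \sum_(w <- ws) f w ^+ k *: v w = 0) ->
  forall w, w \in ws -> v w = 0.
Proof.
move=> f_inj uws v0 w0 w0s.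
have poly0 (p : {poly K}) : \sum_(w <- ws) p.[f w] *: v w = 0.
  under eq_bigr do rewrite horner_coef scaler_suml.
  rewrite exchange_big big1 //= => i _.
  under eq_bigr do rewrite -scalerA.
  by rewrite -scaler_sumr v0 scaler0.
have := poly0 (\prod_(u <- rem w0 ws) ('X - (f u)%:P)).
rewrite (bigD1_seq w0) //= [X in _ + X]big1_seq ?addr0 => [|w /andP[nw ws_w]].
  move/eqP; rewrite scaler_eq0 => /orP[|/eqP //].
  rewrite horner_prod prodf_seq_eq0 => /hasP[u + /=].
  rewrite (rem_filter _ uws) mem_filter => /andP[/= nu _].
  by rewrite !hornerE subr_eq0 (inj_eq f_inj) eq_sym (negPf nu).
rewrite horner_prod (big_rem w) /=; last by rewrite (rem_filter _ uws) mem_filter /= nw.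
by rewrite !hornerE subrr mul0r scale0r.
Qed.

(** Jacobi: [[[x, h], q] = [x, [h, q]] - [h, [x, q]]], and both terms on the right vanish. *)
Lemma commutator_comm (A : pzRingType) (x h q : A) :
  GRing.comm x q -> GRing.comm x (h * q - q * h) -> GRing.comm (x * h - h * x) q.
Proof.
rewrite /GRing.comm => xq; rewrite !mulrBr !mulrBl !mulrA => /eqP.
rewrite subr_eq => /eqP ->.
by rewrite -(mulrA h x) xq mulrA -xq addrAC (addrAC (h * q * x)) subrr add0r addrC.
Qed.

Lemma comm_commutator (A : pzRingType) (x y q : A) :
  GRing.comm x q -> GRing.comm y q -> GRing.comm (x * y - y * x) q.
Proof.
move=> xq yq; apply: commr_sym.
by apply: commrB; apply: commrM; apply: commr_sym.
Qed.

Lemma commutator_oppsum (A : pzRingType) (T1 T2 : finType) (P1 : pred T1) (P2 : pred T2)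
    (x : A) (f1 : T1 -> A) (f2 : T2 -> A) :
  x * (- (\sum_(t | P1 t) f1 t) - \sum_(t | P2 t) f2 t)
  - (- (\sum_(t | P1 t) f1 t) - \sum_(t | P2 t) f2 t) * x
  = - (\sum_(t | P1 t) (x * f1 t - f1 t * x)) - \sum_(t | P2 t) (x * f2 t - f2 t * x).
Proof.
rewrite mulrBr mulrBl mulrN mulNr !mulr_sumr !mulr_suml !sumrB.
by rewrite !opprD !opprK addrACA.
Qed.

Lemma eq_opp_sub (W : zmodType) (x y z : W) : z = - x - y -> y = - z - x.
Proof. by move=> ->; rewrite opprB opprK addrK. Qed.

(** * Gauge shifts and holonomies seen on the region *)

Section Traces.
Variables (R : realType) (gT : finGroupType) (N : nat) (V : {set edge N}).
Hypothesis (N2 : (2 <= N)%N).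
Hypotheses (Vs : star_connected V) (Vp : plaquette_connected V) (V2 : (2 <= #|V|)%N).
Local Notation C := (R[i]).
Local Notation chars := (@Defs.chars R gT).
Implicit Types (e : edge N) (s : vertex N) (p : plaq N) (g : gT) (chi : {ffun gT -> C}).

Lemma stars_ofP s : s \in stars_of V -> exists2 e, e \in V & e \in dstar s.
Proof. by rewrite inE => /pred0Pn[e /andP[es eV]]; exists e. Qed.

Lemma plaqs_ofP p : p \in plaqs_of V -> exists2 e, e \in V & e \in bplaq p.
Proof. by rewrite inE => /pred0Pn[e /andP[es eV]]; exists e. Qed.

Lemma star_cfg1 s e : star_cfg s (1%g : gT) e = 1%g.
Proof. by rewrite ffunE invg1 !if_same mulg1. Qed.

Lemma star_cfg_neq1 s g e : g != 1%g -> (star_cfg s g e != 1%g) = (e \in dstar s).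
Proof.
move=> g1; rewrite mem_dstar ffunE; case: (src e =P s) => [es|_]; case: (tgt e =P s) => [et|_] /=;
  rewrite ?mulg1 ?mul1g ?eqxx ?invg_eq1 //.
by have := src_neq_tgt e N2; rewrite es et eqxx.
Qed.

(** For a nontrivial [g] the shift is nontrivial exactly on the star, so its trace on [V] determines
    [s]; the value at a single edge then determines [g]. *)
Lemma star_cfg_inj s s' g g' : s \in stars_of V -> g != 1%g ->
  (forall e, e \in V -> star_cfg s g e = star_cfg s' g' e) -> s = s' /\ g = g'.
Proof.
move=> /stars_ofP[e0 e0V e0s] g1 same.
have g1' : g' != 1%g.
  apply: contraTneq e0s => g'1.
  by rewrite -(star_cfg_neq1 _ _ g1) same // g'1 star_cfg1 eqxx.
have ss' : s = s'.
  apply: (star_trace_inj Vs Vp V2 e0V e0s) => e eV.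
  by rewrite -(star_cfg_neq1 _ _ g1) -(star_cfg_neq1 _ _ g1') same.
split=> //; move: e0s (same e0 e0V); rewrite -ss' mem_dstar !ffunE.
(* Since [e0] is not a loop, its value is either [g] or its inverse, never their product. *)
case: (src e0 =P s) => [es|_]; case: (tgt e0 =P s) => [et|_] //= _; rewrite ?mulg1 ?mul1g //.
  by have := src_neq_tgt e0 N2; rewrite es et eqxx.
exact: invg_inj.
Qed.

Definition triv_char : {ffun gT -> C} := [ffun=> 1].

Lemma triv_charP : chars triv_char.
Proof. by split=> [g k|g]; rewrite !ffunE ?mulr1 ?normr1. Qed.

Lemma conjc_eq1 (z : C) : conjc z = 1 -> z = 1.
Proof. by move/(congr1 conjc); rewrite conjcK => ->; exact: conjc1. Qed.

Lemma hol_single_eq1 p chi e g : chars chi -> chi g = 1 -> hol p chi (single e g) = 1.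
Proof.
move=> hchi chi1; rewrite hol_single // chi1 if_same mul1r.
by case: ifP => // _; exact: conjc1.
Qed.

Lemma hol_single_neq1 p chi e g : chars chi -> chi g != 1 ->
  (hol p chi (single e g) != 1) = (e \in bplaq p).
Proof.
move=> hchi chi1; rewrite mem_bplaq hol_single //.
case: (ccw e =P p) => [es|_]; case: (cw e =P p) => [et|_] /=; rewrite ?mulr1 ?mul1r ?eqxx //.
  by have := ccw_neq_cw e N2; rewrite es et eqxx.
by apply: contraNneq chi1 => /conjc_eq1 ->.
Qed.

(** Testing on [single e g0] with [chi g0 != 1] recovers the trace of the plaquette on [V]; varying
    the group element at one edge of that trace then recovers [chi]. *)
Lemma hol_inj p p' chi chi' : p \in plaqs_of V -> chars chi -> chars chi' ->
  chi != triv_char ->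
  (forall e g, e \in V -> hol p chi (single e g) = hol p' chi' (single e g)) ->
  p = p' /\ chi = chi'.
Proof.
move=> /plaqs_ofP[e0 e0V e0p] hchi hchi' chi_nt same.
have [g0 g01] : exists g, chi g != 1.
  apply/existsP; apply: contraNT chi_nt; rewrite negb_exists => /forallP chi1.
  by apply/eqP/ffunP => g; rewrite ffunE; apply/eqP; have := chi1 g; rewrite negbK.
have g01' : chi' g0 != 1.
  apply: contraTneq e0p => /(hol_single_eq1 p' e0 hchi') E.
  by rewrite -(hol_single_neq1 _ _ hchi g01) same // E eqxx.
have pp' : p = p'.
  apply: (plaq_trace_inj Vs Vp V2 e0V e0p) => e eV.
  by rewrite -(hol_single_neq1 _ _ hchi g01) -(hol_single_neq1 _ _ hchi' g01') same.
split=> //; apply/ffunP => g.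
move: e0p (same e0 g e0V); rewrite -pp' mem_bplaq !hol_single //.
case: (ccw e0 =P p) => [es|_]; case: (cw e0 =P p) => [et|_] //= _; rewrite ?mulr1 ?mul1r //.
  by have := ccw_neq_cw e0 N2; rewrite es et eqxx.
exact: (can_inj (@conjcK R)).
Qed.

Definition trivial_off_set : {set cfg gT N} := [set c : cfg gT N | [forall e, (e \notin V) ==> (c e == 1%g)]].

Lemma trivial_offP c : reflect (trivial_off V c) (c \in trivial_off_set).
Proof.
rewrite inE; apply: (iffP forallP) => cV e; first by move=> eV; apply/eqP; apply: (implyP (cV e)).
by apply/implyP => eV; rewrite cV.
Qed.

(** Holonomies restrict to characters of the group of configurations trivial off [V], and by
    [hol_inj] the pair [p0], [chi0] gives a character different from all others. This is
    orthogonality of characters on that group. *)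
Lemma hol_orthogonal p p0 chi chi0 : p0 \in plaqs_of V -> chars chi0 -> chars chi ->
  chi0 != triv_char ->
  \sum_(c in trivial_off_set) conjc (hol p0 chi0 c) * hol p chi c
  = if (p == p0) && (chi == chi0) then #|trivial_off_set|%:R else 0.
Proof.
move=> p0V hchi0 hchi chi0_nt; case: ifPn => [/andP[/eqP -> /eqP ->]|ne].
  rewrite (eq_bigr (fun=> 1)); last by move=> c _; rewrite mulrC hol_norm.
  by rewrite sumr_const.
set psi := fun c => conjc (hol p0 chi0 c) * hol p chi c.
have psiM c d : psi (cmul c d) = psi c * psi d.
  rewrite /psi !holM // [RHS]mulrACA; congr (_ * _); exact: rmorphM.
have [e [g [eV neq]]] : exists e g, e \in V /\ hol p0 chi0 (single e g) != hol p chi (single e g).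
  apply: contrapT => nex; move/negP: ne; apply.
  have [-> ->] : p0 = p /\ chi0 = chi; last by rewrite !eqxx.
  apply: hol_inj => // e g eV; apply/eqP; apply: contrapT => /negP neq.
  by apply: nex; exists e, g.
have psi1 : psi (single e g) != 1.
  apply: contraNneq neq => E; apply/eqP.
  by rewrite -[LHS]mulr1 -E /psi mulrA hol_norm // mul1r.
(* Translating the summation variable multiplies the sum by a number other than 1, so the sum is
   zero. *)
have : psi (single e g) * \sum_(c in trivial_off_set) psi c = \sum_(c in trivial_off_set) psi c.
  rewrite [RHS](reindex_inj (can_inj (cmulK (single e g)))) /= mulr_sumr.
  apply: eq_big => [c|c _]; last by rewrite psiM.
  apply/trivial_offP/trivial_offP => cV e' e'V; have := cV e' e'V;
    rewrite !ffunE; case: eqP e'V => [->|_ _]; rewrite ?eV ?mul1g //.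
move/eqP; rewrite -subr_eq0 -[X in _ - X]mul1r -mulrBl mulf_eq0 subr_eq0 (negPf psi1).
by move/eqP.
Qed.

End Traces.

(** * Local symmetries *)

Section LocalSymmetries.
Variables (R : realType) (gT : finGroupType) (N : nat) (V : {set edge N}).
Local Notation C := (R[i]).
Local Notation cfg := (cfg gT N).
Local Notation Op := (Op R gT N).
Local Notation chars := (@Defs.chars R gT).
Local Notation charseq := (finmap.enum_fset (fset_set chars)).
Local Notation A := (@Astar R gT N).
Local Notation B := (@Bplaq R gT N).
Local Notation H := (Ham R gT [set: edge N]).
Implicit Types (a b c x y : cfg) (X Y O : Op) (e : edge N).
Implicit Types (s : vertex N) (p : plaq N) (g : gT) (chi : {ffun gT -> C}).

Let card_gT_neq0 : (#|{: gT}|%:R : C) != 0.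
Proof. by rewrite pnatr_eq0 -lt0n; apply/card_gt0P; exists 1%g. Qed.

Lemma cmulE a b e : cmul a b e = (a e * b e)%g.
Proof. by rewrite ffunE. Qed.

Lemma cinvE a e : cinv a e = ((a e)^-1)%g.
Proof. by rewrite ffunE. Qed.

Lemma ent_comm_shift O c x y :
  ent (O *m shift_op R c - shift_op R c *m O) x y
  = ent O x (cmul c y) - ent O (cmul (cinv c) x) y.
Proof. by rewrite entD entN ent_mul_shift -{2}[x](cmulKV c) ent_shift_mul. Qed.

Lemma ent_comm_Astar O s x y :
  ent (O *m A s - A s *m O) x y = (#|{: gT}|%:R)^-1 *
    \sum_g (ent O x (cmul (star_cfg s g) y) - ent O (cmul (cinv (star_cfg s g)) x) y).
Proof.
rewrite AstarE -scalemxAr -scalemxAl -scalerBr entZ; congr (_ * _).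
rewrite mulmx_sumr mulmx_suml -sumrB ent_sum; apply: eq_bigr => g _.
exact: ent_comm_shift.
Qed.

Lemma ent_comm_Bplaq O p x y :
  ent (O *m B p - B p *m O) x y = (#|{: gT}|%:R)^-1 *
    (ent O x y * \sum_(chi <- charseq) (hol p chi y - hol p chi x)).
Proof.
rewrite BplaqE entD entN ent_mul_diag ent_diag_mul sumrB !mulrBr mulrCA; congr (_ - _).
by rewrite -mulrA; congr (_ * _); exact: mulrC.
Qed.

Lemma comm_Ham O W : O *m Ham R gT W - Ham R gT W *m O
  = - (\sum_(s in stars_of W) (O *m A s - A s *m O))
    - \sum_(p in plaqs_of W) (O *m B p - B p *m O).
Proof.
exact: (commutator_oppsum (fun s => s \in stars_of W) (fun p => p \in plaqs_of W) O A B).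
Qed.

Lemma ent_oppsum (T1 T2 : finType) (P1 : pred T1) (P2 : pred T2)
    (f1 : T1 -> Op) (f2 : T2 -> Op) x y :
  ent (- (\sum_(t | P1 t) f1 t) - \sum_(t | P2 t) f2 t) x y
  = - (\sum_(t | P1 t) ent (f1 t) x y) - \sum_(t | P2 t) ent (f2 t) x y.
Proof. by rewrite entD !entN !ent_sum. Qed.

Lemma ent_comm_Ham O W x y : ent (O *m Ham R gT W - Ham R gT W *m O) x y
  = - (\sum_(s in stars_of W) ent (O *m A s - A s *m O) x y)
    - \sum_(p in plaqs_of W) ent (O *m B p - B p *m O) x y.
Proof. by rewrite comm_Ham; exact: ent_oppsum. Qed.

Lemma hol_triv p a : hol p (triv_char R gT) a = 1.
Proof. by rewrite /hol !big1 ?mulr1 // => e _; rewrite !ffunE ?conjc1. Qed.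

Lemma sub_stars_of : stars_of V \subset stars_of [set: edge N].
Proof.
apply/fintype.subsetP => s; rewrite !inE; apply: contraNN => d.
by apply: disjointWr d; apply: finset.subsetT.
Qed.

Lemma sub_plaqs_of : plaqs_of V \subset plaqs_of [set: edge N].
Proof.
apply/fintype.subsetP => s; rewrite !inE; apply: contraNN => d.
by apply: disjointWr d; apply: finset.subsetT.
Qed.

Section FromCommutator.
Hypothesis (N2 : (2 <= N)%N).
Hypotheses (Vs : star_connected V) (Vp : plaquette_connected V) (V2 : (2 <= #|V|)%N).
Variable O : Op.
Hypotheses (sO : supported_in (~: V) O) (sX : supported_in (~: V) (O *m H - H *m O)).

(* The entry of [[O, H]] at (c a, b), where [c] is the shift of [A_s(g)], only
   receives a contribution from [A_s(g)] itself. *)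
Lemma star_shift_invariant s g a b : s \in stars_of V -> g != 1%g -> agree_on V a b ->
  ent O (cmul (star_cfg s g) a) (cmul (star_cfg s g) b) = ent O a b.
Proof.
move=> sV g1 /agree_onP ab; set c := star_cfg s g.
have [e0 e0V e0s] := stars_ofP sV.
(* At [e0] the two indices differ, so the support of [[O, H]] makes its entry vanish, and so do all
   plaquette contributions. *)
have ne0 : cmul c a e0 != b e0.
  rewrite ffunE ab // -[X in _ == X]mul1g (inj_eq (mulIg _)).
  by rewrite (star_cfg_neq1 N2 s _ g1).
have X0 := supported_ent0 sX e0V ne0.
(* Any other shift disagrees with [c] somewhere on [V], where the support of [O] kills both
   entries. *)
have other s' g' : (s', g') != (s, g) ->
    ent O (cmul c a) (cmul (star_cfg s' g') b)
    - ent O (cmul (cinv (star_cfg s' g')) (cmul c a)) b = 0.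
  move=> ne; have [e [eV nee]] : exists e, e \in V /\ c e != star_cfg s' g' e.
    apply: contrapT => nex; move/negP: ne; apply.
    have [-> ->] : s = s' /\ g = g'; last by rewrite eqxx.
    apply: (star_cfg_inj N2 Vs Vp V2 sV g1) => e eV.
    by apply/eqP; apply: contrapT => /negP nee; apply: nex; exists e.
  rewrite (supported_ent0 sO eV) ?(supported_ent0 sO eV) ?subrr //.
    rewrite !cmulE cinvE ab // mulgA -[X in _ == X]mul1g (inj_eq (mulIg _)).
    by rewrite -eq_mulVg1 eq_sym.
  by rewrite !cmulE ab // (inj_eq (mulIg _)).
move: X0; rewrite ent_comm_Ham.
rewrite [X in _ - X]big1 ?subr0 => [|p _]; last first.
  by rewrite ent_comm_Bplaq (supported_ent0 sO e0V ne0) mul0r mulr0.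
move/eqP; rewrite oppr_eq0 (bigD1 s) /=; last exact: (fintype.subsetP sub_stars_of).
rewrite [X in _ + X]big1 ?addr0 => [|s' /andP[_ ns]]; last first.
  rewrite ent_comm_Astar big1 ?mulr0 // => g' _; apply: other.
  by rewrite xpair_eqE (negPf ns).
rewrite ent_comm_Astar (bigD1 g) //= [X in _ + X]big1 ?addr0 => [|g' ng]; last first.
  by apply: other; rewrite xpair_eqE (negPf ng) andbF.
rewrite mulf_eq0 invr_eq0 (negPf card_gT_neq0) /= subr_eq0 => /eqP ->.
by rewrite cmulK.
Qed.

Lemma local_star_symmetry s : s \in stars_of V -> O *m A s = A s *m O.
Proof.
move=> sV; rewrite AstarE -scalemxAr -scalemxAl mulmx_sumr mulmx_suml; congr (_ *: _).
apply: eq_bigr => g _; have [->|g1] := eqVneq g 1%g.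
  have -> : star_cfg s 1%g = cone gT N by apply/ffunP => e; rewrite star_cfg1 ffunE.
  by rewrite shift_op1 mulmx1 mul1mx.
set c := star_cfg s g; apply: entP => x y.
rewrite ent_mul_shift -[x](cmulKV c) ent_shift_mul; move: (cmul (cinv c) x) => a.
have [ab|] := boolP (agree_on V a y); first exact: star_shift_invariant.
case/forall_inPn => e eV ne.
rewrite !(supported_ent0 sO eV) //.
by rewrite !ffunE (inj_eq (mulgI _)).
Qed.

Variables (I : finType) (S : edge N -> I -> siteOp R gT).
Hypothesis irr : forall e (X : siteOp R gT),
  (forall i, X *m S e i = S e i *m X) -> exists c : C, X = c%:M.

(** A star meeting [V] already commutes with [O]; one missing [V] commutes with all operators on
    [V], as does [O]. *)
Lemma supported_comm_Astar s : supported_in (~: V) (O *m A s - A s *m O).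
Proof.
apply: (supported_of_comm irr) => e i eV.
have cO := supported_comm sO (S e i) eV.
have [sV|sV] := boolP (s \in stars_of V).
  by rewrite local_star_symmetry // subrr mul0mx mulmx0.
have cA := Astar_emb_comm (S e i) sV eV.
exact: (comm_commutator cO cA).
Qed.

(** Removing the star commutators from [[O, H]] leaves the plaquette part, and everything removed
    lies in the commutant of the region. *)
Lemma supported_comm_plaqs :
  supported_in (~: V) (\sum_(p in plaqs_of [set: edge N]) (O *m B p - B p *m O)).
Proof.
apply: (supported_of_comm irr) => e i eV.
rewrite (eq_opp_sub (comm_Ham O [set: edge N])).
apply: (@commr_sym (Op : pzRingType)); apply: commrB.
  by apply: commrN; exact/esym/(supported_comm sX (S e i) eV).
apply: commr_sum => s _.
exact/esym/(supported_comm (supported_comm_Astar s) (S e i) eV).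
Qed.

(** Translating [a] and [b] by [c] inside [V] changes neither the nonzero entry of [O] nor that of
    the plaquette commutator, so [Phi] is constant. It is also a combination of the characters
    [hol q eta c] with coefficients [hol q eta b - hol q eta a]; pairing with [hol p chi] isolates
    one coefficient. *)
Lemma hol_locally_equal a b p chi : ent O a b != 0 -> p \in plaqs_of V -> chars chi ->
  hol p chi a = hol p chi b.
Proof.
move=> Oab pV hchi; have [->|chi_nt] := eqVneq chi (triv_char R gT).
  by rewrite !hol_triv.
pose Phi c := \sum_(q in plaqs_of [set: edge N]) \sum_(eta <- charseq)
  (hol q eta (cmul c b) - hol q eta (cmul c a)).
have PhiE c : ent (\sum_(q in plaqs_of [set: edge N]) (O *m B q - B q *m O)) (cmul c a) (cmul c b)
    = (#|{: gT}|%:R)^-1 * (ent O (cmul c a) (cmul c b) * Phi c).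
  rewrite ent_sum /Phi !mulr_sumr; apply: eq_bigr => q _; exact: ent_comm_Bplaq.
have Phi_const c : c \in trivial_off_set gT V -> Phi c = Phi (cone gT N).
  move/trivial_offP => cV.
  have := supported_translate supported_comm_plaqs a b cV.
  rewrite PhiE -{2}[a]cmul1c -{2}[b]cmul1c PhiE !cmul1c (supported_translate sO) //.
  by move/(mulfI (invr_neq0 card_gT_neq0))/(mulfI Oab).
(* A constant is a multiple of the trivial holonomy, hence orthogonal to the nontrivial
   [hol p chi]. *)
have F0 : \sum_(c in trivial_off_set gT V) conjc (hol p chi c) * Phi c = 0.
  rewrite (eq_bigr (fun c => conjc (hol p chi c) * hol p (triv_char R gT) c * Phi (cone gT N))).
    rewrite -mulr_suml hol_orthogonal //; last exact: triv_charP.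
    by rewrite eqxx eq_sym (negPf chi_nt) mul0r.
  by move=> c cV; rewrite Phi_const // hol_triv mulr1.
have : \sum_(q in plaqs_of [set: edge N]) \sum_(eta <- charseq)
    (hol q eta b - hol q eta a) *
    \sum_(c in trivial_off_set gT V) conjc (hol p chi c) * hol q eta c = 0.
  rewrite -[RHS]F0 /Phi; under [RHS]eq_bigr do rewrite mulr_sumr.
  rewrite [RHS]exchange_big; apply: eq_bigr => q _ /=.
  under [RHS]eq_bigr do rewrite mulr_sumr.
  rewrite [RHS]exchange_big !big_seq; apply: eq_bigr => eta /mem_chars heta /=.
  rewrite mulr_sumr; apply: eq_bigr => c _.
  by rewrite !holM // -mulrBr [RHS]mulrA; exact: mulrC.
rewrite (bigD1 p) /=; last exact: (fintype.subsetP sub_plaqs_of).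
rewrite [X in _ + X]big1 ?addr0 => [|q /andP[_ nq]]; last first.
  rewrite big_seq big1 // => eta /mem_chars heta.
  by rewrite hol_orthogonal // (negPf nq) mulr0.
rewrite (bigD1_seq chi) ?fset_uniq //=; last exact/mem_chars.
rewrite [X in _ + X]big1_seq ?addr0 => [|eta /andP[neta /mem_chars heta]]; last first.
  by rewrite hol_orthogonal // (negPf neta) andbF mulr0.
rewrite hol_orthogonal // !eqxx /= => /eqP; rewrite mulf_eq0 pnatr_eq0 => /orP[|].
  by rewrite subr_eq0 => /eqP.
rewrite -leqn0 leqNgt => /negP[]; apply/card_gt0P; exists (cone gT N).
by apply/trivial_offP => e _; rewrite ffunE.
Qed.

Lemma local_plaq_symmetry p : p \in plaqs_of V -> O *m B p = B p *m O.
Proof.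
move=> pV; apply/eqP; rewrite -subr_eq0; apply/eqP/entP => a b.
rewrite ent_comm_Bplaq ent0; have [->|Oab] := eqVneq (ent O a b) 0.
  by rewrite mul0r mulr0.
rewrite big_seq big1 ?mulr0 // => chi /mem_chars hchi.
by rewrite (hol_locally_equal Oab) ?subrr.
Qed.

End FromCommutator.
End LocalSymmetries.

(** * From local symmetries back to the frequency components *)

(** The remainder [h - hV] commutes with [q] and [hV], hence with every iterate, so [h] may be
    replaced by [hV] in each commutator; [x] commutes with [q] and [hV]. *)
Lemma iter_commutator_comm (A : pzRingType) (x h hV q : A) :
  GRing.comm x q -> GRing.comm x hV -> GRing.comm (h - hV) q -> GRing.comm (h - hV) hV ->
  forall k, GRing.comm x (iter k (fun y => h * y - y * h) q).
Proof.
move=> xq xhV rq rhV k.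
suff [] : GRing.comm x (iter k (fun y => h * y - y * h) q)
   /\ GRing.comm (h - hV) (iter k (fun y => h * y - y * h) q) by [].
elim: k => [//|k [xy ry]]; rewrite iterS; set y := iter k _ q in xy ry *.
have -> : h * y - y * h = hV * y - y * hV.
  have := ry; rewrite /GRing.comm mulrBl mulrBr => /eqP; rewrite subr_eq => /eqP ->.
  by rewrite addrAC (addrAC (y * h)) subrr add0r addrC.
by split; apply: commrB; apply: commrM.
Qed.

Lemma iter_commutator_eigen (K : fieldType) m (h : 'M[K]_m) (T : Type) (f : T -> K)
    (ws : seq T) (F : T -> 'M[K]_m) :
  (forall w, h *m F w - F w *m h = f w *: F w) -> forall k,
  iter k (fun y => h *m y - y *m h) (\sum_(w <- ws) F w) = \sum_(w <- ws) f w ^+ k *: F w.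
Proof.
move=> eig; elim=> [|k IH]; first by apply: eq_bigr => w _; rewrite expr0 scale1r.
rewrite iterS IH mulmx_sumr mulmx_suml -sumrB; apply: eq_bigr => w _.
by rewrite -scalemxAr -scalemxAl -scalerBr eig scalerA -exprSr.
Qed.

(** The iterated commutators of [h] with [q] are the power moments of the components [F w]; [x]
    commutes with each moment, and Vandermonde separates the components. *)
Lemma comm_eigencomponents (K : fieldType) m (x h hV : 'M[K]_m) (T : eqType) (f : T -> K)
    (ws : seq T) (F : T -> 'M[K]_m) (q := \sum_(w <- ws) F w) :
  injective f -> uniq ws -> (forall w, h *m F w - F w *m h = f w *: F w) ->
  GRing.comm x q -> GRing.comm x hV -> GRing.comm (h - hV) q -> GRing.comm (h - hV) hV ->
  forall w, w \in ws -> x *m F w = F w *m x.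
Proof.
move=> f_inj uws eig xq xhV rq rhV w ws_w; apply/eqP; rewrite -subr_eq0; apply/eqP.
apply: (vandermonde_eq0 (v := fun w => x *m F w - F w *m x) f_inj uws _ ws_w) => k.
have := iter_commutator_comm xq xhV rq rhV k.
rewrite [iter _ _ _](iter_commutator_eigen ws eig k) => xE.
transitivity (x *m (\sum_(w <- ws) f w ^+ k *: F w) - (\sum_(w <- ws) f w ^+ k *: F w) *m x).
  rewrite mulmx_sumr mulmx_suml -sumrB; apply: eq_bigr => u _.
  by rewrite -scalemxAr -scalemxAl scalerBr.
by rewrite [_ *m _]xE subrr.
Qed.

Lemma oppsum_split (W : zmodType) (a a' b b' : W) :
  (- (a + a') - (b + b')) - (- a - b) = - a' - b'.
Proof.
by rewrite !opprD !opprK (addrACA (- a)) [LHS]addrAC -[- a - b]opprD addNr add0r.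
Qed.

Section HamComm.
Variables (R : realType) (gT : finGroupType) (N : nat) (V : {set edge N}).
Local Notation Op := (Op R gT N).
Local Notation A := (@Astar R gT N).
Local Notation B := (@Bplaq R gT N).
Local Notation H := (Ham R gT [set: edge N]).
Implicit Types (O : Op) (X : siteOp R gT) (e : edge N) (W : {set edge N}).

Lemma comm_oppsum (K : pzRingType) (T1 T2 : finType) (P1 : pred T1) (P2 : pred T2)
    (x : K) (f1 : T1 -> K) (f2 : T2 -> K) :
  (forall t, P1 t -> GRing.comm x (f1 t)) -> (forall t, P2 t -> GRing.comm x (f2 t)) ->
  GRing.comm x (- (\sum_(t | P1 t) f1 t) - \sum_(t | P2 t) f2 t).
Proof. by move=> c1 c2; apply: commrB; [apply: commrN|]; apply: commr_sum. Qed.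

Lemma Ham_comm_local O W :
  (forall s, s \in stars_of W -> O *m A s = A s *m O) ->
  (forall p, p \in plaqs_of W -> O *m B p = B p *m O) ->
  O *m Ham R gT W = Ham R gT W *m O.
Proof. exact: (@comm_oppsum Op). Qed.

Lemma Ham_comm W W' : abelian [set: gT] ->
  Ham R gT W *m Ham R gT W' = Ham R gT W' *m Ham R gT W.
Proof.
move=> abG; apply: Ham_comm_local => [s|p] _; apply/esym; apply: Ham_comm_local => [s'|p'] _.
- exact: Astar_comm.
- exact: Astar_Bplaq_comm.
- exact/esym/Astar_Bplaq_comm.
- exact: Bplaq_comm.
Qed.

(** Only terms missing the region remain, which is why the difference commutes with every operator
    on the region. *)
Lemma Ham_sub : H - Ham R gT V =
  - (\sum_(s in stars_of [set: edge N] :\: stars_of V) A s)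
  - \sum_(p in plaqs_of [set: edge N] :\: plaqs_of V) B p.
Proof.
have split (T : finType) (D D' : {set T}) (F : T -> Op) : D' \subset D ->
    \sum_(t in D) F t = \sum_(t in D') F t + \sum_(t in D :\: D') F t.
  by move=> D'D; rewrite (big_setID D') /= (finset.setIidPr D'D).
rewrite /Ham (split _ _ _ A (sub_stars_of V)) (split _ _ _ B (sub_plaqs_of V)).
exact: oppsum_split.
Qed.

Lemma Ham_sub_emb_comm e X : e \in V ->
  (H - Ham R gT V) *m emb e X = emb e X *m (H - Ham R gT V).
Proof.
move=> eV; rewrite Ham_sub; apply/esym/(@comm_oppsum Op) => [s|p];
  rewrite inE => /andP[nV _]; apply/esym.
- exact: Astar_emb_comm nV eV.
- exact: Bplaq_emb_comm nV eV.
Qed.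

Lemma freqcomp_comm_local O e X w : abelian [set: gT] -> e \in V ->
  supported_in (~: V) O ->
  (forall s, s \in stars_of V -> O *m A s = A s *m O) ->
  (forall p, p \in plaqs_of V -> O *m B p = B p *m O) ->
  bohr H w -> O *m freqcomp H (emb e X) w = freqcomp H (emb e X) w *m O.
Proof.
move=> abG eV sO cA cB wb; have hH := Ham_adj R abG [set: edge N].
have sumQ := sum_freqcomp hH (emb e X).
apply: (@comm_eigencomponents _ _ O H (Ham R gT V) _ (fun u => (u%:C)%C)
          (finmap.enum_fset (fset_set (bohr H))) (fun u => freqcomp H (emb e X) u)).
- exact: complexI.
- exact: fset_uniq.
- move=> u; exact: freqcomp_comm.
- rewrite sumQ; exact: (supported_comm sO X eV).
- exact: (Ham_comm_local cA cB).
- rewrite sumQ; exact: (Ham_sub_emb_comm X eV).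
- apply: commr_sym; apply: commrB; exact: (Ham_comm _ _ abG).
- by rewrite -[_ \in _]/(w \in fset_set _) in_fset_set; [exact/mem_set | exact: finite_bohr].
Qed.

(** [Q] and [[H, Q]] are the zeroth and first moments of the frequency components. *)
Lemma comm_of_freqcomp O Q : adj H = H ->
  (forall w, bohr H w -> O *m freqcomp H Q w = freqcomp H Q w *m O) ->
  O *m Q = Q *m O /\ O *m (H *m Q - Q *m H) = (H *m Q - Q *m H) *m O.
Proof.
move=> hH cO.
have cO' w : w \in finmap.enum_fset (fset_set (bohr H)) ->
    O *m freqcomp H Q w = freqcomp H Q w *m O.
  by rewrite -[_ \in _]/(w \in fset_set _) in_fset_set; [move/set_mem; exact: cO | exact: finite_bohr].
split.
  rewrite -(sum_freqcomp hH Q) mulmx_sumr mulmx_suml big_seq [RHS]big_seq.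
  by apply: eq_bigr => w /cO'.
have -> : H *m Q - Q *m H = \sum_(w <- fset_set (bohr H)) (w%:C)%C *: freqcomp H Q w.
  rewrite -{1 2}(sum_freqcomp hH Q) mulmx_sumr mulmx_suml -sumrB.
  by apply: eq_bigr => w _; exact: freqcomp_comm.
rewrite mulmx_sumr mulmx_suml big_seq [RHS]big_seq.
by apply: eq_bigr => w /cO' cw; rewrite -scalemxAr -scalemxAl cw.
Qed.

End HamComm.

(** * Both inclusions for the kernel on a connected region *)

Unset Implicit Arguments.
Set Strict Implicit.

Theorem mainTheorem4
  (R : realType) (gT : finGroupType) (N : nat) (I : finType)
  (S : edge N -> I -> siteOp R gT) (h : edge N -> I -> R -> R)
  (beta : R) (Rg : {set edge N}) :
  abelian [set: gT] ->
  (2 <= N)%N ->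
  (forall e i, exists j, S e j = adj (S e i)) ->
  (forall e (X : siteOp R gT),
      (forall i, X *m S e i = S e i *m X) -> exists c : R[i], X = c%:M) ->
  (forall e i w, 0 < h e i w) ->
  (forall e i w, h e i (- w) = h e i w * expR (- (beta * w))) ->
  0 <= beta ->
  star_connected Rg -> plaquette_connected Rg -> (2 <= #|Rg|)%N ->
  forall O : Op R gT N,
    davies S h Rg O = 0 <->
    [/\ supported_in (~: Rg) O,
        (forall s, s \in stars_of Rg -> O *m Astar R gT s = Astar R gT s *m O) &
        (forall p, p \in plaqs_of Rg -> O *m Bplaq R gT p = Bplaq R gT p *m O)].
Proof.
move=> abG N2 S_adj irr h_gt0 _ _ Vs Vp V2 O.
have hH := Ham_adj R abG [set: edge N].
rewrite (davies_kernel S_adj h_gt0 hH); split=> [cO | [sO cA cB] e i w eV wb].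
  have loc e i : e \in Rg -> _ := fun eV => comm_of_freqcomp hH (fun w wb => cO e i w eV wb).
  have sO : supported_in (~: Rg) O.
    by apply: (supported_of_comm irr) => e i eV; case: (loc e i eV).
  (* Jacobi turns commutation with [Q] and [[H, Q]] into commutation of [[O, H]] with each bare
     jump, and irreducibility applies again. *)
  have sX : supported_in (~: Rg) (O *m Ham R gT [set: edge N] - Ham R gT [set: edge N] *m O).
    apply: (supported_of_comm irr) => e i eV; case: (loc e i eV) => cQ cHQ.
    exact: (commutator_comm cQ cHQ).
  split=> // [s sV | p pV].
    exact: local_star_symmetry N2 Vs Vp V2 _ sO sX _ sV.
  exact: local_plaq_symmetry N2 Vs Vp V2 _ sO sX _ _ irr _ pV.
exact: (freqcomp_comm_local (S e i) abG eV sO cA cB wb).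
Qed.
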